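(* Let $d\ge 1$, let $\mathcal{U}_d\subset\mathbb{C}^{d\times d}$ be the unit sphere of matrices of Frobenius norm $1$, let $\overline{\mathrm{E}}:\mathcal{U}_d\to\mathbb{R}$ be $\overline{\mathrm{E}}(A)=\|AA^*-A^*A\|^2$, and let $\overline{\mathcal{F}}:\mathcal{U}_d\times[0,\infty)\to\mathcal{U}_d$ be its negative Riemannian gradient flow. For any non-nilpotent $A_0\in\mathcal{U}_d$, the limit $A_\infty=\lim_{t\to\infty}\overline{\mathcal{F}}(A_0,t)$ exists, is normal, and has Frobenius norm $1$. Moreover, if $A_0$ has real entries, then so does $A_\infty$.
   Context: $\mathbb{C}^{d\times d}$ is regarded as a real inner product space with $\langle A,B\rangle=\mathrm{Re}\,\mathrm{tr}(B^*A)$; $\|\cdot\|$ is the Frobenius norm, $\|B\|^2=\sum_{i,j}|b_{ij}|^2$. $\mathcal{U}_d=\{A\in\mathbb{C}^{d\times d}:\|A\|=1\}$ is a $(2d^2-1)$-dimensional sphere with the induced Riemannian metric. A matrix $A$ is normal if $AA^*=A^*A$. The flow $\overline{\mathcal{F}}$ is defined by $\overline{\mathcal{F}}(A_0,0)=A_0$ and $\frac{d}{dt}\overline{\mathcal{F}}(A_0,t)=-\mathrm{grad}\,\overline{\mathrm{E}}(\overline{\mathcal{F}}(A_0,t))$, where $\mathrm{grad}$ is the Riemannian gradient on $\mathcal{U}_d$. *)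

(* Defs.v *)
From HB Require Import structures.
From mathcomp Require Import all_boot all_order all_algebra.
From mathcomp Require Import complex.
From mathcomp Require Import all_classical all_reals all_analysis.
From mathcomp Require Import ring lra.

Set Implicit Arguments.
Unset Strict Implicit.
Unset Printing Implicit Defensive.

Import Order.TTheory GRing.Theory Num.Theory.
Import numFieldNormedType.Exports.

Local Open Scope classical_set_scope.
Local Open Scope ring_scope.
Local Open Scope sesquilinear_scope.
Local Open Scope complex_scope.

(* An alias of 'M[R[i]]_d that carries the structure of a *real* normed space,
   with the Frobenius norm; the library only equips matrices with the max norm
   and with scalars from the coefficient ring. *)
Definition cmat (R : realType) (d : nat) : Type := 'M[R[i]]_d.

HB.instance Definition _ (R : realType) (d : nat) :=
  GRing.Zmodule.copy (cmat R d) 'M[R[i]]_d.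

Section FrobeniusNorm.
Context {R : realType} {d : nat}.
Implicit Types (A B C : cmat R d) (a b : R).

Definition cmat_scale a A : cmat R d := a%:C *: (A : 'M[R[i]]_d).

Fact cmat_scaleA a b A : cmat_scale a (cmat_scale b A) = cmat_scale (a * b) A.
Proof. by rewrite /cmat_scale rmorphM scalerA. Qed.

Fact cmat_scale1 : left_id 1 cmat_scale.
Proof. by move=> A; rewrite /cmat_scale rmorph1 scale1r. Qed.

Fact cmat_scaleDr : right_distributive cmat_scale +%R.
Proof. by move=> a A B; rewrite /cmat_scale scalerDr. Qed.

Fact cmat_scaleDl A : {morph cmat_scale^~ A : a b / a + b}.
Proof. by move=> a b; rewrite /cmat_scale rmorphD scalerDl. Qed.

HB.instance Definition _ := GRing.Zmodule_isLmodule.Build R (cmat R d)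
  cmat_scaleA cmat_scale1 cmat_scaleDr cmat_scaleDl.

Definition frob_norm A : R :=
  Num.sqrt (\sum_i \sum_j ComplexField.Normc.normc (A i j) ^+ 2).

Definition frob_inner A B : R :=
  complex.Re (\tr ((B : 'M[R[i]]_d)^t* *m (A : 'M[R[i]]_d))).

Lemma frob_innerE A B : frob_inner A B =
  \sum_i \sum_j (complex.Re (A i j) * complex.Re (B i j) +
                 complex.Im (A i j) * complex.Im (B i j)).
Proof.
rewrite /frob_inner /mxtrace raddf_sum exchange_big /=.
apply: eq_bigr => j _; rewrite mxE raddf_sum /=.
apply: eq_bigr => i _; rewrite !mxE.
by case: (A i j) (B i j) => [a b] [a' b'] /=; ring.
Qed.

Lemma frob_norm_inner A : frob_norm A = Num.sqrt (frob_inner A A).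
Proof.
rewrite frob_innerE /frob_norm; congr Num.sqrt.
apply: eq_bigr => i _; apply: eq_bigr => j _.
case: (A i j) => a b /=.
by rewrite sqr_sqrtr ?addr_ge0 ?sqr_ge0// !expr2.
Qed.

Lemma frob_innerC A B : frob_inner A B = frob_inner B A.
Proof.
by rewrite !frob_innerE; apply: eq_bigr => i _; apply: eq_bigr => j _; ring.
Qed.

Lemma frob_innerDl A B C :
  frob_inner (A + B) C = frob_inner A C + frob_inner B C.
Proof.
rewrite !frob_innerE -big_split; apply: eq_bigr => i _ /=.
rewrite -big_split; apply: eq_bigr => j _ /=.
by rewrite mxE; case: (A i j) (B i j) => [a b] [a' b'] /=; ring.
Qed.

Lemma frob_innerZl a A B : frob_inner (a *: A) B = a * frob_inner A B.
Proof.
rewrite !frob_innerE mulr_sumr; apply: eq_bigr => i _.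
rewrite mulr_sumr; apply: eq_bigr => j _.
by rewrite /GRing.scale /= mxE; case: (A i j) => [x y] /=; ring.
Qed.

Lemma frob_innerDr A B C :
  frob_inner C (A + B) = frob_inner C A + frob_inner C B.
Proof. by rewrite frob_innerC frob_innerDl !(frob_innerC C). Qed.

Lemma frob_innerZr a A B : frob_inner B (a *: A) = a * frob_inner B A.
Proof. by rewrite frob_innerC frob_innerZl frob_innerC. Qed.

Lemma frob_inner_ge0 A : 0 <= frob_inner A A.
Proof.
rewrite frob_innerE; apply: sumr_ge0 => i _; apply: sumr_ge0 => j _.
by rewrite addr_ge0// -expr2 sqr_ge0.
Qed.

Lemma frob_inner_eq0 A : frob_inner A A = 0 -> A = 0.
Proof.
have sq_ge0 i j : 0 <= complex.Re (A i j) * complex.Re (A i j) +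
                       complex.Im (A i j) * complex.Im (A i j).
  by rewrite addr_ge0// -expr2 sqr_ge0.
rewrite frob_innerE => /eqP.
rewrite psumr_eq0 => [|i _]; last exact: sumr_ge0.
move=> /allP A0; apply/matrixP => i j.
move: (A0 i (mem_index_enum i)); rewrite psumr_eq0//.
move=> /allP/(_ j (mem_index_enum j)) /=.
rewrite -!expr2 paddr_eq0 ?sqr_ge0// !sqrf_eq0.
by rewrite mxE; case: (A i j) => x y /= /andP[/eqP -> /eqP ->].
Qed.

Lemma frob_CauchySchwarz A B :
  frob_inner A B ^+ 2 <= frob_inner A A * frob_inner B B.
Proof.
have := frob_inner_ge0 A; rewrite le_eqVlt => /orP[/eqP A0|A0].
  rewrite (frob_inner_eq0 (esym A0)).
  by rewrite -(scale0r (0 : cmat R d)) !frob_innerZl !mul0r expr0n.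
have := frob_inner_ge0 (frob_inner A A *: B + - frob_inner A B *: A).
rewrite !(frob_innerDl, frob_innerDr, frob_innerZl, frob_innerZr).
rewrite (frob_innerC B A) => h.
rewrite -subr_ge0 -(pmulr_rge0 _ A0); apply: le_trans h _.
by rewrite le_eqVlt; apply/orP; left; apply/eqP; ring.
Qed.

Fact frob_normD A B : frob_norm (A + B) <= frob_norm A + frob_norm B.
Proof.
rewrite !frob_norm_inner -[leRHS]ger0_norm ?addr_ge0 ?sqrtr_ge0//.
rewrite -sqrtr_sqr ler_sqrt ?sqr_ge0// sqrrD !sqr_sqrtr ?frob_inner_ge0//.
rewrite frob_innerDl !frob_innerDr (frob_innerC B A) addrA lerD2r.
rewrite -addrA lerD2l -mulr2n lerMn2r /=; apply: le_trans (ler_norm _) _.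
by rewrite -sqrtr_sqr -sqrtrM ?frob_inner_ge0// ler_wsqrtr// frob_CauchySchwarz.
Qed.

Fact frob_normZ a A : frob_norm (a *: A) = `|a| * frob_norm A.
Proof.
rewrite !frob_norm_inner frob_innerZl frob_innerZr mulrA -expr2.
by rewrite sqrtrM ?sqr_ge0// sqrtr_sqr.
Qed.

Fact frob_norm_eq0 A : frob_norm A = 0 -> A = 0.
Proof.
rewrite frob_norm_inner => /eqP; rewrite sqrtr_eq0 => A0.
by apply/frob_inner_eq0/eqP; rewrite eq_le A0 frob_inner_ge0.
Qed.

HB.instance Definition _ := Lmodule_isNormed.Build R (cmat R d)
  frob_normD frob_normZ frob_norm_eq0.

Lemma cmat_normE A : `|A| = frob_norm A. Proof. by []. Qed.

End FrobeniusNorm.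

Section RiemannianGradient.
Context {R : realType} {d : nat}.
Implicit Types (S : set (cmat R d)) (A V W : cmat R d).

Definition curve_through S A W (c : R -> cmat R d) : Prop :=
  [/\ forall s, S (c s), c 0 = A & is_derive (0 : R) 1 c W].

Definition tangent_space S A : set (cmat R d) :=
  [set W | exists c, curve_through S A W c].

(* V is the gradient at A of f : S -> R for the metric induced on S: it is
   tangent to S and represents the differential of f.  Only the values of f
   on S matter. *)
Definition is_riemannian_gradient S (f : cmat R d -> R) A V : Prop :=
  tangent_space S A V /\
  forall W c, curve_through S A W c ->
    is_derive (0 : R) 1 (f \o c) (frob_inner V W).

Definition has_derivative_within (D : set R) (g : R -> cmat R d) (t : R) V :=
  (x - t)^-1 *: (g x - g t) @[x --> within D t^'] --> V.

(* F is total; only its values at A0 in S and t >= 0 are constrained.  The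
   derivative at t = 0 is the right derivative. *)
Definition is_negative_gradient_flow S (f : cmat R d -> R)
    (F : cmat R d -> R -> cmat R d) : Prop :=
  forall A0, S A0 ->
    F A0 0 = A0 /\
    forall t, 0 <= t ->
      S (F A0 t) /\
      exists2 V, is_riemannian_gradient S f (F A0 t) V &
        has_derivative_within [set x | 0 <= x] (F A0) t (- V).

End RiemannianGradient.

Definition unit_sphere (R : realType) (d : nat) : set (cmat R d) :=
  [set A | `|A| = 1].

Definition nonnormality (R : realType) (d : nat) (A : cmat R d) : R :=
  `| ((A : 'M[R[i]]_d) *m A^t* - A^t* *m A : cmat R d) | ^+ 2.

Definition nilpotent_mx (R : pzRingType) (d : nat) (A : 'M[R]_d) : Prop :=
  exists k : nat, A ^+ k = 0.

(* Main.v *)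
(* Write [M = A A^* - A^* A] and [E = |M|^2].  The flow is
   [A' = -4 [M, A] + 4 E A], and [E' = -|A'|^2].

   Since [-4 [M, A]] is an infinitesimal conjugation, [tr (A^k)' = 4 k E tr (A^k)];
   some [tr (A0^k)] is nonzero when [A0] is not nilpotent, and [|tr (A^k)|] stays
   bounded on the sphere, so the nonincreasing [E] must tend to [0].

   Convergence follows from the Lojasiewicz inequality [|M|^3 <= C |[M, A]|^2].
   In an eigenbasis of [M], with eigenvalues [mu_i] and weights [w_ij = |a_ij|^2],
   it reads [(sum mu_i^2)^(3/2) <= C sum (mu_i - mu_j)^2 w_ij], where [mu_i] is the
   net outflow [sum_j (w_ij - w_ji)]: cutting the nodes at a large gap between the
   [mu_i], the net flow across the cut gives the bound.  Hence
   [|A'| >= c E^(3/4)] once [E] is small, so [c E^(1/4)] decreases at least as fast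
   as arc length grows and the trajectory has finite length. *)

Require Import Defs.
From mathcomp Require Import all_boot all_order all_algebra.
From mathcomp Require Import complex.
From mathcomp Require Import all_classical all_reals all_analysis.
From mathcomp Require Import ring lra.

Import Order.TTheory GRing.Theory Num.Theory.
Import numFieldNormedType.Exports.

Local Open Scope classical_set_scope.
Local Open Scope ring_scope.

Set Implicit Arguments.
Unset Strict Implicit.
Unset Printing Implicit Defensive.

(** * Entrywise calculus for complex matrix curves in a real variable *)

Section EntrywiseCalculus.

Local Open Scope sesquilinear_scope.
Local Open Scope complex_scope.

Context {R : realType}.
Local Notation C := R[i].
Local Notation Re := complex.Re.
Local Notation Im := complex.Im.

Lemma is_derive_cvgP (V : normedModType R) (c : R -> V) (t : R) (W : V) :
  is_derive t 1 c W <-> h^-1 *: (c (h + t) - c t) @[h --> 0^'] --> W.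
Proof.
have E : (fun h => h^-1 *: ((c \o shift t) (h *: (1 : R)) - c t)) =
         (fun h => h^-1 *: (c (h + t) - c t)).
  by apply/funext => h /=; rewrite /GRing.scale /= mulr1.
split=> [[cd <-]|cW]; first by move: cd; rewrite /derivable /derive E.
split; rewrite /derivable /derive E; first by apply/cvg_ex; exists W.
exact: cvg_lim.
Qed.

(** The variable is real, so the derivative is split into two real ones, to which the real calculus
    rules apply. *)
Definition is_cderive (f : R -> C) (t : R) (w : C) : Prop :=
  is_derive t 1 (fun s => Re (f s)) (Re w) /\
  is_derive t 1 (fun s => Im (f s)) (Im w).

Lemma is_cderive_cst (z : C) t : is_cderive (fun=> z) t 0.
Proof. by split; exact: is_derive_cst. Qed.

Lemma is_cderiveD f g t w z : is_cderive f t w -> is_cderive g t z ->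
  is_cderive (fun s => f s + g s) t (w + z).
Proof.
move=> [fr fi] [gr gi]; split; rewrite raddfD.
- by under eq_fun do rewrite raddfD; exact: is_deriveD.
- by under eq_fun do rewrite raddfD; exact: is_deriveD.
Qed.

Lemma is_cderiveN f t w : is_cderive f t w ->
  is_cderive (fun s => - f s) t (- w).
Proof.
move=> [fr fi]; split; rewrite raddfN.
- by under eq_fun do rewrite raddfN; exact: is_deriveN.
- by under eq_fun do rewrite raddfN; exact: is_deriveN.
Qed.

Lemma is_cderive_conj f t w : is_cderive f t w ->
  is_cderive (fun s => (f s)^*) t w^*.
Proof.
move=> [fr fi]; split.
- have -> : (fun s => Re (f s)^*) = (fun s => Re (f s)).
    by apply/funext => s; case: (f s).
  by case: w fr {fi}.
- have -> : (fun s => Im (f s)^*) = - (fun s => Im (f s)).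
    by apply/funext => s; rewrite !fctE; case: (f s).
  have -> : Im w^* = - Im w by case: w {fr fi}.
  exact: is_deriveN.
Qed.

Lemma is_cderiveM f g t w z : is_cderive f t w -> is_cderive g t z ->
  is_cderive (fun s => f s * g s) t (w * g t + f t * z).
Proof.
move=> [fr fi] [gr gi]; split.
- have -> : (fun s => Re (f s * g s)) =
    (fun s => Re (f s)) * (fun s => Re (g s)) -
    (fun s => Im (f s)) * (fun s => Im (g s)).
    by apply/funext => s; rewrite !fctE; case: (f s) (g s) => [a b] [a' b'].
  apply: is_derive_eq.
  case: (f t) (g t) w z {fr fi gr gi} => [a b] [a' b'] [u v] [u' v'] /=.
  by rewrite /GRing.scale /=; ring.
- have -> : (fun s => Im (f s * g s)) =
    (fun s => Re (f s)) * (fun s => Im (g s)) +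
    (fun s => Im (f s)) * (fun s => Re (g s)).
    by apply/funext => s; rewrite !fctE; case: (f s) (g s) => [a b] [a' b'].
  apply: is_derive_eq.
  case: (f t) (g t) w z {fr fi gr gi} => [a b] [a' b'] [u v] [u' v'] /=.
  by rewrite /GRing.scale /=; ring.
Qed.

Lemma is_cderive_sum (I : Type) (r : seq I) (f : I -> R -> C) t (w : I -> C) :
  (forall i, is_cderive (f i) t (w i)) ->
  is_cderive (fun s => \sum_(i <- r) f i s) t (\sum_(i <- r) w i).
Proof.
move=> fw; elim: r => [|i r IH].
  by rewrite big_nil; under eq_fun do rewrite big_nil; exact: is_cderive_cst.
by rewrite big_cons; under eq_fun do rewrite big_cons; exact: is_cderiveD.
Qed.

Definition is_mxderive m n (A : R -> 'M[C]_(m, n)) t (W : 'M[C]_(m, n)) :=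
  forall i j, is_cderive (fun s => A s i j) t (W i j).

Lemma is_mxderive_cst m n (B : 'M[C]_(m, n)) t : is_mxderive (fun=> B) t 0.
Proof. by move=> i j; rewrite mxE; exact: is_cderive_cst. Qed.

Lemma is_mxderiveD m n (A B : R -> 'M[C]_(m, n)) t W Z :
  is_mxderive A t W -> is_mxderive B t Z ->
  is_mxderive (fun s => A s + B s) t (W + Z).
Proof.
move=> AW BZ i j; rewrite mxE; under eq_fun do rewrite mxE.
exact: is_cderiveD.
Qed.

Lemma is_mxderiveN m n (A : R -> 'M[C]_(m, n)) t W :
  is_mxderive A t W -> is_mxderive (fun s => - A s) t (- W).
Proof.
by move=> AW i j; rewrite mxE; under eq_fun do rewrite mxE; exact: is_cderiveN.
Qed.

Lemma is_mxderiveB m n (A B : R -> 'M[C]_(m, n)) t W Z :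
  is_mxderive A t W -> is_mxderive B t Z ->
  is_mxderive (fun s => A s - B s) t (W - Z).
Proof. by move=> AW BZ; apply: is_mxderiveD => //; exact: is_mxderiveN. Qed.

Lemma is_mxderive_adj m n (A : R -> 'M[C]_(m, n)) t W :
  is_mxderive A t W -> is_mxderive (fun s => (A s)^t*) t (W^t*).
Proof.
move=> AW i j; rewrite !mxE; under eq_fun do rewrite !mxE.
exact: is_cderive_conj.
Qed.

Lemma is_mxderiveM m n p (A : R -> 'M[C]_(m, n)) (B : R -> 'M[C]_(n, p))
    t W Z :
  is_mxderive A t W -> is_mxderive B t Z ->
  is_mxderive (fun s => A s *m B s) t (W *m B t + A t *m Z).
Proof.
move=> AW BZ i j; rewrite !mxE -big_split /=; under eq_fun do rewrite !mxE.
by apply: is_cderive_sum => k; exact: is_cderiveM.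
Qed.

Lemma is_cderive_trace n (A : R -> 'M[C]_n) t W :
  is_mxderive A t W -> is_cderive (fun s => \tr (A s)) t (\tr W).
Proof. by move=> AW; apply: is_cderive_sum => i; exact: AW. Qed.

Lemma is_derive_frob_inner d (A B : R -> cmat R d) t (W Z : cmat R d) :
  is_mxderive A t W -> is_mxderive B t Z ->
  is_derive t 1 (fun s => frob_inner (A s) (B s))
    (frob_inner W (B t) + frob_inner (A t) Z).
Proof.
move=> AW BZ; have /is_mxderive_adj BZ' := BZ.
have [dRe _] := is_cderive_trace (is_mxderiveM BZ' AW).
by apply: is_derive_eq; rewrite mxtraceD raddfD addrC.
Qed.

End EntrywiseCalculus.

(** * Frobenius geometry, commutators and the differential of the energy *)

Section FrobeniusAlgebra.

Local Open Scope sesquilinear_scope.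
Local Open Scope complex_scope.

Context {R : realType}.
Local Notation C := R[i].
Local Notation Re := complex.Re.
Local Notation Im := complex.Im.

Lemma normc_ge0 (z : C) : 0 <= Normc.normc z.
Proof. by case: z => a b; exact: sqrtr_ge0. Qed.

Lemma adjmxM m n p (A : 'M[C]_(m, n)) (B : 'M[C]_(n, p)) :
  (A *m B)^t* = B^t* *m A^t*.
Proof. by rewrite trmx_mul map_mxM. Qed.

Lemma adjmxB m n (A B : 'M[C]_(m, n)) : (A - B)^t* = A^t* - B^t*.
Proof. by rewrite linearB map_mxB. Qed.

Context {d : nat}.
Implicit Types A B W X Y : cmat R d.

Lemma frob_innerNl A B : frob_inner (- A) B = - frob_inner A B.
Proof. by rewrite -scaleN1r frob_innerZl mulN1r. Qed.

Lemma frob_innerNr A B : frob_inner A (- B) = - frob_inner A B.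
Proof. by rewrite frob_innerC frob_innerNl frob_innerC. Qed.

Lemma frob_innerBl A B W :
  frob_inner (A - B) W = frob_inner A W - frob_inner B W.
Proof. by rewrite frob_innerDl frob_innerNl. Qed.

Lemma frob_innerBr A B W :
  frob_inner W (A - B) = frob_inner W A - frob_inner W B.
Proof. by rewrite frob_innerDr frob_innerNr. Qed.

(** Here the sum is read in ['M[C]_d] instead of [cmat], so that the rule rewrites sums of matrix
    products. *)
Lemma mxfrob_innerDl (A B W : 'M[C]_d) :
  frob_inner (A + B) W = frob_inner A W + frob_inner B W.
Proof. exact: (@frob_innerDl R d). Qed.

Lemma mxfrob_innerBl (A B W : 'M[C]_d) :
  frob_inner (A - B) W = frob_inner A W - frob_inner B W.
Proof. exact: (@frob_innerBl A B W). Qed.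

Lemma frob_inner_adj (A B : 'M[C]_d) : frob_inner (A^t*) (B^t*) = frob_inner A B.
Proof.
rewrite !frob_innerE exchange_big; apply: eq_bigr => i _.
apply: eq_bigr => j _; rewrite !mxE.
by case: (A i j) (B i j) => [a b] [a' b'] /=; ring.
Qed.

Lemma frob_inner_mulr (A B W : 'M[C]_d) :
  frob_inner (A *m B) W = frob_inner A (W *m B^t*).
Proof.
by rewrite /frob_inner adjmxM trmxCK mulmxA mxtrace_mulC mulmxA.
Qed.

Lemma frob_inner_mull (A B W : 'M[C]_d) :
  frob_inner (B *m A) W = frob_inner A (B^t* *m W).
Proof. by rewrite /frob_inner adjmxM trmxCK mulmxA. Qed.

Lemma cmat_sqr_norm A : `|A| ^+ 2 = frob_inner A A.
Proof. by rewrite cmat_normE frob_norm_inner sqr_sqrtr// frob_inner_ge0. Qed.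

Lemma frob_inner_le_norm A B : `|frob_inner A B| <= `|A| * `|B|.
Proof.
rewrite !cmat_normE !frob_norm_inner -sqrtrM ?frob_inner_ge0// -sqrtr_sqr.
by rewrite ler_wsqrtr// frob_CauchySchwarz.
Qed.

Lemma cmat_norm_adj (A : cmat R d) :
  `|((A : 'M[C]_d)^t* : cmat R d)| = `|A|.
Proof. by rewrite !cmat_normE !frob_norm_inner frob_inner_adj. Qed.

(** Lagrange's identity: the double sum of [(x i * y j - x j * y i) ^+ 2] is twice the defect. *)
Lemma sum_CauchySchwarz (I : finType) (x y : I -> R) :
  (\sum_i x i * y i) ^+ 2 <= (\sum_i x i ^+ 2) * (\sum_i y i ^+ 2).
Proof.
suff E : \sum_i \sum_j (x i * y j - x j * y i) ^+ 2 =
    2 * ((\sum_i x i ^+ 2) * (\sum_i y i ^+ 2) - (\sum_i x i * y i) ^+ 2).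
  rewrite -subr_ge0 -(pmulr_rge0 _ (ltr0Sn R 1)) -E.
  by apply: sumr_ge0 => i _; apply: sumr_ge0 => j _; exact: sqr_ge0.
transitivity (\sum_i \sum_j (x i ^+ 2 * y j ^+ 2) +
   \sum_i \sum_j (x j ^+ 2 * y i ^+ 2) -
   2 * (\sum_i \sum_j (x i * y i) * (x j * y j))).
  rewrite mulr_sumr -sumrN -!big_split; apply: eq_bigr => i _ /=.
  rewrite mulr_sumr -sumrN -!big_split; apply: eq_bigr => j _ /=; ring.
rewrite [X in _ + X - _]exchange_big -!big_distrlr /=; ring.
Qed.

(** Triangle inequality in each entry of the product, then Cauchy-Schwarz for a row of [A] and a
    column of [B]. *)
Lemma cmat_normM (A B : 'M[C]_d) :
  `|(A *m B : cmat R d)| <= `|(A : cmat R d)| * `|(B : cmat R d)|.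
Proof.
rewrite !cmat_normE /frob_norm -sqrtrM; last first.
  by apply: sumr_ge0 => i _; apply: sumr_ge0 => j _; exact: sqr_ge0.
apply: ler_wsqrtr; rewrite mulr_suml.
rewrite [in leRHS](exchange_big _ _ _ _ _ (fun i j => Normc.normc (B i j) ^+ 2)).
apply: ler_sum => i _; rewrite mulr_sumr; apply: ler_sum => j _.
apply: le_trans (sum_CauchySchwarz _ _).
rewrite ler_sqr ?nnegrE ?sumr_ge0//; first last.
- by move=> k _; rewrite mulr_ge0// normc_ge0.
- exact: normc_ge0.
rewrite mxE; elim/big_ind2: _ => [|x1 x2 y1 y2 h1 h2|k _].
- by rewrite Normc.normc0.
- by apply: (le_trans (le_normcD _ _)); exact: lerD.
- by rewrite Normc.normcM.
Qed.

(** The matrix [M] of the overview; [dblcomm] is then [[M, A]]. *)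
Definition selfcomm (A : 'M[C]_d) : 'M[C]_d := A *m A^t* - A^t* *m A.

Definition dblcomm (A : 'M[C]_d) : 'M[C]_d :=
  selfcomm A *m A - A *m selfcomm A.

Lemma selfcomm_adj A : (selfcomm A)^t* = selfcomm A.
Proof. by rewrite /selfcomm adjmxB !adjmxM trmxCK. Qed.

Lemma nonnormalityE A :
  nonnormality A = frob_inner (selfcomm A) (selfcomm A).
Proof. exact: cmat_sqr_norm. Qed.

Lemma frob_inner_dblcomm A :
  frob_inner (dblcomm A) A = frob_inner (selfcomm A) (selfcomm A).
Proof.
by rewrite /dblcomm frob_innerBl frob_inner_mulr frob_inner_mull -frob_innerBr.
Qed.

(** The derivative of [|M|^2] is [2 <M, M'>]; as [M] is Hermitian, the four terms of [<M, M'>] pair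
    up into [2 <[M, A], W>]. So the Euclidean gradient is [4 [M, A]]. *)
Lemma is_derive_nonnormality (c : R -> cmat R d) t W : is_mxderive c t W ->
  is_derive t 1 (fun s => nonnormality (c s)) (4 * frob_inner (dblcomm (c t)) W).
Proof.
move=> cW; have cW' := is_mxderive_adj cW.
have dM := is_mxderiveB (is_mxderiveM cW cW') (is_mxderiveM cW' cW).
have := is_derive_frob_inner dM dM.
under [X in _ -> is_derive _ _ X _]eq_fun do rewrite nonnormalityE.
rewrite -/(selfcomm _) => dE; apply: is_derive_eq.
set A := c t; set M := selfcomm A.
have MA : M^t* = M := selfcomm_adj A.
have -> : frob_inner (dblcomm A) W =
    frob_inner W (M *m A) - frob_inner W (A *m M).
  by rewrite /dblcomm mxfrob_innerBl !(frob_innerC _ W).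
rewrite (frob_innerC M).
rewrite mxfrob_innerBl !mxfrob_innerDl.
have -> : frob_inner (W *m A^t*) M = frob_inner W (M *m A).
  by rewrite frob_inner_mulr trmxCK.
have -> : frob_inner (A *m W^t*) M = frob_inner W (M *m A).
  by rewrite frob_inner_mull -frob_inner_adj adjmxM !trmxCK MA.
have -> : frob_inner (W^t* *m A) M = frob_inner W (A *m M).
  by rewrite frob_inner_mulr -frob_inner_adj adjmxM !trmxCK MA.
have -> : frob_inner (A^t* *m W) M = frob_inner W (A *m M).
  by rewrite frob_inner_mull trmxCK.
ring.
Qed.

End FrobeniusAlgebra.

Lemma is_derive_unique (R : numFieldType) (V W : normedModType R) (f : V -> W)
    (x v : V) (a b : W) :
  is_derive x v f a -> is_derive x v f b -> a = b.
Proof. by move=> [_ <-] [_ <-]. Qed.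

Lemma bounded_additive_continuous (R : realType) (V : normedModType R)
    (l : V -> R) (K : R) :
  (forall x y, l (x - y) = l x - l y) -> (forall x, `|l x| <= K * `|x|) ->
  continuous l.
Proof.
move=> lB lK x; apply/cvgrPdist_lt => e e0.
(* The constant [K] may be zero or negative; [|K| + 1] can be divided by. *)
have K0 : 0 < `|K| + 1 by rewrite ltr_wpDl.
near=> y.
rewrite -lB; apply: le_lt_trans (lK _) _.
apply: (@le_lt_trans _ _ ((`|K| + 1) * `|x - y|)).
  by rewrite ler_wpM2r// (le_trans (ler_norm _))// lerDl.
rewrite mulrC -ltr_pdivlMr//.
near: y; apply: cvgr_dist_lt => //.
exact: divr_gt0.
Unshelve. all: by end_near.
Qed.

(** * The Riemannian gradient on the sphere *)

Section SphereGradient.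

Local Open Scope sesquilinear_scope.
Local Open Scope complex_scope.

Context {R : realType} {d : nat}.
Local Notation C := R[i].
Local Notation Re := complex.Re.
Local Notation Im := complex.Im.
Implicit Types A B V W X : cmat R d.

(** For [z = 1] and [z = 'i] this exhibits the two parts of an entry as bounded functionals, which
    links the normed derivative to the entrywise one. *)
Lemma frob_inner_delta A (z : C) i j :
  frob_inner A (z *: delta_mx i j : 'M[C]_d) =
    Re (A i j) * Re z + Im (A i j) * Im z.
Proof.
rewrite frob_innerE (bigD1 i)//= (bigD1 j)//= big1 => [|k /negPf kj]; last first.
  by rewrite !mxE kj andbF mulr0 /= !mulr0 addr0.
rewrite big1 => [|k /negPf ki]; last first.
  by apply: big1 => l _; rewrite !mxE ki mulr0 /= !mulr0 addr0.
by rewrite !mxE !eqxx mulr1 !addr0.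
Qed.

Lemma Re_entry A i j : Re (A i j) = frob_inner A (1 *: delta_mx i j : 'M[C]_d).
Proof. by rewrite frob_inner_delta mulr1 mulr0 addr0. Qed.

Lemma Im_entry A i j :
  Im (A i j) = frob_inner A ('i *: delta_mx i j : 'M[C]_d).
Proof. by rewrite frob_inner_delta mulr1 mulr0 add0r. Qed.

Lemma continuous_frob_inner B : continuous (fun A : cmat R d => frob_inner A B).
Proof.
apply: (@bounded_additive_continuous _ _ _ `|B|) => [X Y|X].
  exact: frob_innerBl.
by rewrite mulrC; exact: frob_inner_le_norm.
Qed.

Lemma is_derive_frob_innerl (c : R -> cmat R d) (t : R) W B :
  is_derive t (1 : R) c W ->
  is_derive t 1 (fun s => frob_inner (c s) B) (frob_inner W B).
Proof.
move=> /is_derive_cvgP cW; apply/is_derive_cvgP.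
under eq_fun do rewrite -frob_innerBl /GRing.scale /= -frob_innerZl.
exact: (cvg_comp _ _ cW (@continuous_frob_inner B W)).
Qed.

Lemma is_derive_mxderive (c : R -> cmat R d) (t : R) W :
  is_derive t (1 : R) c W -> is_mxderive c t W.
Proof.
move=> cW i j; split.
- by under eq_fun do rewrite Re_entry; rewrite Re_entry; exact: is_derive_frob_innerl.
- by under eq_fun do rewrite Im_entry; rewrite Im_entry; exact: is_derive_frob_innerl.
Qed.

Lemma is_derive_scalel (a : R -> R) (t a' : R) A :
  is_derive t 1 a a' -> is_derive t 1 (fun s => a s *: A) (a' *: A).
Proof.
move=> /is_derive_cvgP ha; apply/is_derive_cvgP.
under eq_fun do rewrite -scalerBl scalerA.
exact: cvgZr_tmp.
Qed.

Lemma unit_sphereE A : unit_sphere A <-> frob_inner A A = 1.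
Proof.
rewrite /unit_sphere /= -cmat_sqr_norm; split=> [->|]; first exact: expr1n.
by move=> /eqP; rewrite sqrp_eq1// => /eqP.
Qed.

(** Differentiate [<c, c> = 1] along a curve [c] of the sphere. *)
Lemma tangent_unit_sphere A V :
  tangent_space (@unit_sphere R d) A V -> frob_inner V A = 0.
Proof.
move=> [c [cS <- /is_derive_mxderive cV]].
have := is_derive_frob_inner cV cV.
under eq_fun do rewrite (iffLR (unit_sphereE _) (cS _)).
move=> /is_derive_unique/(_ (is_derive_cst (1 : R) (0 : R) (1 : R)))/eqP.
by rewrite (frob_innerC V) -mulr2n mulrn_eq0 frob_innerC => /eqP.
Qed.

(* With [u = s^2 |W|^2 / 4], the points ((1 - u) A + s W) / (1 + u) parametrise
   the great circle through [A] in the direction [W]. *)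
Lemma curve_unit_sphere A W : unit_sphere A -> frob_inner A W = 0 ->
  exists c, curve_through (@unit_sphere R d) A W c.
Proof.
move=> /unit_sphereE A1 AW.
pose n := frob_inner W W / 4.
have n0 : 0 <= n by rewrite divr_ge0// frob_inner_ge0.
pose u s := s ^+ 2 * n.
have u1 s : 1 + u s != 0.
  by rewrite gt_eqF// ltr_pwDl// mulr_ge0// sqr_ge0.
exists (fun s => ((1 - u s) / (1 + u s)) *: A + (s / (1 + u s)) *: W); split.
- move=> s; apply/unit_sphereE.
  rewrite !(frob_innerDl, frob_innerDr, frob_innerZl, frob_innerZr).
  rewrite (frob_innerC W A) AW A1.
  have -> : frob_inner W W = 4 * n by rewrite /n; field.
  by have := u1 s; rewrite /u => us; field.
- by rewrite /u expr0n/= !mul0r subr0 addr0 divr1 scale1r scale0r addr0.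
(* [u] vanishes to second order at [0], so the velocity there comes only from the coefficient of
   [W]. *)
- have du : is_derive (0 : R) (1 : R) u 0.
    have -> : u = (fun s => n * (s * s)).
      by apply/funext => s; rewrite /u expr2 mulrC.
    have dss : is_derive (0 : R) (1 : R) ((id : R -> R) * id) 0.
      by apply: is_derive_eq; rewrite !scale0r addr0.
    by have := is_deriveZ n dss; rewrite scaler0.
  have d1 : is_derive (0 : R) (1 : R) (fun s => 1 + u s) 0.
    by have := is_deriveD (is_derive_cst (1 : R) (0 : R) (1 : R)) du; rewrite addr0.
  have dV : is_derive (0 : R) (1 : R) (fun s => (1 + u s)^-1) 0.
    by have := is_deriveV (f := fun s => 1 + u s) (u1 0) d1; rewrite scaler0.
  have dB : is_derive (0 : R) (1 : R) (fun s => 1 - u s) 0.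
    by have := is_deriveB (is_derive_cst (1 : R) (0 : R) (1 : R)) du; rewrite subr0.
  rewrite -[X in is_derive _ _ _ X]add0r -(scale0r A) -[X in _ + X]scale1r.
  apply: is_deriveD; apply: is_derive_scalel.
  + by have := is_deriveM dB dV; rewrite !scaler0 addr0.
  + have := is_deriveM (is_derive_id (0 : R) (1 : R)) dV.
    by rewrite /u expr0n/= mul0r addr0 invr1 scale0r add0r scale1r.
Qed.

(** The tangential part of [4 [M, A]]: on the sphere its radial part is [4 E A], since [<[M, A], A>
    = E]. *)
Definition sphere_grad A : cmat R d :=
  4 *: ((dblcomm A : cmat R d) - nonnormality A *: A).

(** The difference [D] of the two candidates is tangent, hence the velocity of a curve; both give
    the derivative of the energy along it, so [<D, D> = 0]. *)
Lemma riemannian_gradientE A V : unit_sphere A ->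
  is_riemannian_gradient (@unit_sphere R d) (@nonnormality R d) A V ->
  V = sphere_grad A.
Proof.
move=> SA [/tangent_unit_sphere VA grad].
have A1 := iffLR (unit_sphereE _) SA.
pose D := V - sphere_grad A.
have GA : frob_inner (sphere_grad A) A = 0.
  rewrite /sphere_grad frob_innerZl frob_innerBl frob_innerZl A1 mulr1.
  by rewrite frob_inner_dblcomm nonnormalityE subrr mulr0.
have DA : frob_inner A D = 0 by rewrite frob_innerBr !(frob_innerC A) VA GA subrr.
have [c cD] := curve_unit_sphere SA DA.
have /(_ _ _ cD) := grad; move: (cD) => [_ c0 /is_derive_mxderive cD'].
have := is_derive_nonnormality cD'.
rewrite c0 => E1 /(is_derive_unique E1) E2.
suff /frob_inner_eq0/eqP : frob_inner D D = 0 by rewrite subr_eq0 => /eqP.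
rewrite {1}/D frob_innerBl /sphere_grad frob_innerZl frob_innerBl frob_innerZl.
by rewrite DA mulr0 subr0 -E2 subrr.
Qed.

End SphereGradient.

(** * Extension of a trajectory to negative times *)

Section TwoSidedExtension.

Context {R : realType}.

(* Extending a trajectory linearly to negative times makes it differentiable
   on both sides at time [0]. *)
Definition linear_extension (V : normedModType R) (g : R -> V) (W : V) (t : R) :=
  if 0 <= t then g t else g 0 + t *: W.

(** For [t > 0] a small ball around [t] contains only nonnegative times; at [t = 0] the left
    difference quotient is exactly [W0]. *)
Lemma is_derive_linear_extension (V : normedModType R) (g : R -> V) (W0 W : V) t :
  0 <= t -> (t = 0 -> W = W0) ->
  (x - t)^-1 *: (g x - g t) @[x --> within [set x | 0 <= x] t^'] --> W ->
  is_derive t 1 (linear_extension g W0) W.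
Proof.
move=> t0 W0E gW; apply/is_derive_cvgP; apply/cvgrPdist_lt => e e0.
move/cvgrPdist_lt : gW => /(_ e e0).
rewrite /prop_near1 /nbhs /= /within /= /dnbhs /within /=.
rewrite -!nbhs_nearE => /nbhs_normP[r /= r0 near_t].
apply/nbhs_normP; exists (if t == 0 then r else Num.min r t).
  by rewrite /=; case: eqVneq => // tN0; rewrite lt_min r0 lt0r tN0 t0.
move=> h /=; rewrite sub0r normrN => hr hN0.
rewrite /linear_extension t0.
case: ifPn => [ht0|]; last first.
  rewrite -ltNge => ht.
  have t_eq0 : t = 0.
    apply/eqP; case: eqVneq hr => // tN0; rewrite lt_min => /andP[_].
    by rewrite ltr_norml => /andP[]; lra.
  rewrite t_eq0 addr0 addrAC subrr add0r scalerA mulVf// scale1r W0E//.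
  by rewrite subrr normr0.
have := near_t (h + t); rewrite addrK; apply => //.
- rewrite /ball_ /= opprD addrCA subrr addr0 normrN.
  by apply: lt_le_trans hr _; case: ifP => // _; rewrite ge_min lexx.
- by rewrite -subr_eq0 addrK.
Qed.

End TwoSidedExtension.

(** * Trajectories as two-sided differentiable curves *)

Section SphereFlow.

Local Open Scope sesquilinear_scope.
Local Open Scope complex_scope.

Context {R : realType} {d : nat}.

(* A trajectory of the flow, defined for all times but constrained only at
   nonnegative ones. *)
Definition is_sphere_flow (A : R -> cmat R d) : Prop :=
  forall t, 0 <= t -> unit_sphere (A t) /\
    is_derive t 1 A (- sphere_grad (A t)).

Lemma negative_gradient_flow_extension (F : cmat R d -> R -> cmat R d) A0 :
  is_negative_gradient_flow (@unit_sphere R d) (@nonnormality R d) F ->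
  unit_sphere A0 ->
  exists A, [/\ is_sphere_flow A, A 0 = A0 & forall t, 0 <= t -> A t = F A0 t].
Proof.
move=> flow SA0; have [F0 FS] := flow A0 SA0.
(* The slope for negative times is the right derivative at [0], so the one-sided derivatives
   agree. *)
pose A := linear_extension (F A0) (- sphere_grad A0).
have AF t : 0 <= t -> A t = F A0 t by rewrite /A /linear_extension => ->.
exists A; split => //; last by rewrite AF.
move=> t t0; have [St [V gradV dV]] := FS t t0.
rewrite AF//; split => //.
have VE := riemannian_gradientE St gradV.
rewrite -VE; apply: is_derive_linear_extension => // tE.
by rewrite VE tE F0.
Qed.

End SphereFlow.

(** * Nilpotency from vanishing traces of powers *)

Section TracesOfPowers.

(** A rank factorisation [e = U V] of an idempotent has [V U = 1], and the trace is cyclic. *)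
Lemma mxtrace_idempotent (F : fieldType) n (e : 'M[F]_n) :
  e *m e = e -> \tr e = (\rank e)%:R.
Proof.
move=> ee; have := mulmx_base e; have /row_fullP[B] := col_base_full e.
have := row_base_free e; move: (col_base e) (row_base e) => U V Vfree BU UV.
suff VU : V *m U = 1%:M by rewrite -{1}UV mxtrace_mulC VU mxtrace1.
suff UVU : U *m (V *m U) = U.
  by rewrite -[LHS]mul1mx -BU -mulmxA UVU BU.
by apply: (row_free_inj Vfree) => /=; rewrite mulmxA UV -mulmxA UV ee.
Qed.

(* If [char_poly A = q 'X^m] with [q(0) != 0], Bezout for ['X^(m+1)] and [q]
   yields an idempotent [e = (u 'X^(m+1))(A)]; its rank is its trace, which
   vanishes as a combination of traces of positive powers, so [e = 0]. *)
Lemma nilpotent_of_traces (F : numFieldType) n (A : 'M[F]_n.+1) :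
  (forall k, \tr (A ^+ k.+1) = 0) -> nilpotent_mx A.
Proof.
move=> trA.
have tr0 p k : \tr (horner_mx A p * A ^+ k.+1) = 0.
  elim/poly_ind: p k => [|p c IH] k; first by rewrite rmorph0 mul0r mxtrace0.
  rewrite rmorphD rmorphM /= horner_mx_X horner_mx_C mulrDl -mulrA -exprS.
  by rewrite mxtraceD IH add0r -mulmxE mul_scalar_mx mxtraceZ trA mulr0.
have [m [q]] := multiplicity_XsubC (char_poly A) 0.
rewrite monic_neq0 ?char_poly_monic//= subr0 => q0 pE.
(* The exponent [m.+1] is positive even when [m = 0]; only traces of positive powers are known to
   vanish. *)
have /Bezout_eq1_coprimepP[[u v] /= uv] : coprimep ('X ^+ m.+1) q.
  by apply: coprimep_expl; rewrite coprimep_sym coprimepX.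
pose e := horner_mx A (u * 'X ^+ m.+1).
have Aq : A ^+ m.+1 * horner_mx A q = 0.
  rewrite -{1}(horner_mx_X A) -rmorphXn -rmorphM exprS -mulrA (mulrC _ q) -pE.
  by rewrite rmorphM /= Cayley_Hamilton mulr0.
have eE : e = horner_mx A u * A ^+ m.+1.
  by rewrite /e rmorphM rmorphXn /= horner_mx_X.
(* This makes [e] idempotent, and once [e = 0] is known it gives [A ^+ m.+1 = 0]. *)
have A1 : A ^+ m.+1 * e = A ^+ m.+1.
  rewrite -[RHS]mulr1 -(rmorph1 (horner_mx A)) -uv rmorphD mulrDr.
  by rewrite (mulrC v) (rmorphM _ q) mulrA Aq mul0r addr0.
have ee : e * e = e by rewrite {1}eE -mulrA A1 -eE.
have := mxtrace_idempotent (ee : e *m e = e).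
rewrite {1}eE tr0 => /esym/eqP; rewrite pnatr_eq0 mxrank_eq0 => /eqP e0.
by exists m.+1; rewrite -A1 e0 mulr0.
Qed.

End TracesOfPowers.

(** * An inequality for net flows between finitely many nodes *)

Section NetFlow.

Context {R : realType}.

(** Otherwise each of the [d] disjoint intervals contains some [mu i], which uses up all [d]
    indices; yet [mu i0] is the excluded right end of the last interval. *)
Lemma exists_gap d (mu : 'I_d -> R) (i0 : 'I_d) : 0 < mu i0 ->
  exists k : 'I_d, forall i,
    ~~ (k%:R * (mu i0 / d%:R) <= mu i < k.+1%:R * (mu i0 / d%:R)).
Proof.
move=> m0; have d0 : 0 < d%:R :> R by rewrite ltr0n (leq_ltn_trans _ (ltn_ord i0)).
have delta0 : 0 < mu i0 / d%:R by exact: divr_gt0.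
apply: contrapT => /forallNP nogap.
have /choice[f fP] : forall k : 'I_d, exists i,
    k%:R * (mu i0 / d%:R) <= mu i < k.+1%:R * (mu i0 / d%:R).
  by move=> k; have /existsNP[i /negP/negPn] := nogap k; exists i.
have f_inj : injective f.
  move=> k l kl; apply/val_inj/eqP; rewrite eqn_leq -(ltnS k) -(ltnS l).
  have /andP[k1 k2] := fP k; have /andP[l1 l2] := fP l.
  rewrite kl in k1 k2.
  have := le_lt_trans k1 l2; have := le_lt_trans l1 k2.
  by rewrite !ltr_pM2r// !ltr_nat => -> ->.
have [g _ gK] := injF_bij f_inj.
have /andP[_] := fP (g i0); rewrite gK.
apply/negP; rewrite -leNgt mulrA ler_pdivrMr// mulrC ler_pM2l// ler_nat.
exact: ltn_ord.
Qed.

(* [mu i] is the net outflow at node [i] of the flow [w].  By pigeonhole some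
   interval of length [mu i0 / d] below [mu i0] contains no [mu i]; the net flow
   [>= mu i0] across that cut is carried by pairs with [mu i - mu j] large. *)
Lemma net_flow_cut d (w : 'I_d -> 'I_d -> R) (mu : 'I_d -> R) (i0 : 'I_d) :
  (forall i j, 0 <= w i j) -> (forall i, mu i = \sum_j (w i j - w j i)) ->
  0 <= mu i0 ->
  mu i0 ^+ 3 <= d%:R ^+ 2 * \sum_i \sum_j (mu i - mu j) ^+ 2 * w i j.
Proof.
move=> w0 muE; rewrite le_eqVlt => /orP[/eqP <-|m0].
  rewrite expr0n /=; apply: mulr_ge0; first exact: sqr_ge0.
  by apply: sumr_ge0 => i _; apply: sumr_ge0 => j _; rewrite mulr_ge0// sqr_ge0.
have d0 : 0 < d%:R :> R by rewrite ltr0n (leq_ltn_trans _ (ltn_ord i0)).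
have [k gap] := exists_gap m0.
set delta := mu i0 / d%:R in gap *.
have delta0 : 0 < delta by exact: divr_gt0.
pose c := k.+1%:R * delta; pose phi i : R := (c <= mu i)%R%:R.
have cm : c <= mu i0.
  by rewrite /c /delta mulrA ler_pdivrMr// mulrC ler_pM2l// ler_nat ltn_ord.
(* The net flow out of the upper side is the sum of [mu] over its nodes, internal flow cancelling;
   all these [mu i] are nonnegative and [mu i0] is one of them. *)
have cross : mu i0 <= \sum_i \sum_j (phi i - phi j) * w i j.
  have -> : \sum_i \sum_j (phi i - phi j) * w i j = \sum_i phi i * mu i.
    transitivity (\sum_i \sum_j phi i * w i j - \sum_i \sum_j phi j * w i j).
      rewrite -sumrB; apply: eq_bigr => i _; rewrite -sumrB.
      by apply: eq_bigr => j _; rewrite mulrBl.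
    rewrite [X in _ - X]exchange_big -sumrB; apply: eq_bigr => i _.
    by rewrite muE mulr_sumr -sumrB; apply: eq_bigr => j _; rewrite mulrBr.
  rewrite (bigD1 i0)//= /phi cm mul1r lerDl; apply: sumr_ge0 => i _.
  case: (leP c (mu i)) => [ci|]; last by rewrite mul0r.
  by rewrite mul1r (le_trans _ ci)// mulr_ge0// ltW.
have -> : mu i0 ^+ 3 = d%:R ^+ 2 * (delta ^+ 2 * mu i0).
  by rewrite /delta; field; rewrite gt_eqF.
rewrite ler_pM2l ?exprn_gt0//.
apply: (@le_trans _ _ (delta ^+ 2 * \sum_i \sum_j (phi i - phi j) * w i j)).
  by rewrite ler_pM2l ?exprn_gt0.
rewrite mulr_sumr; apply: ler_sum => i _; rewrite mulr_sumr; apply: ler_sum => j _.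
rewrite mulrA; apply: ler_wpM2r => //; rewrite /phi.
(* Only pairs going down across the cut count positively, and for these the gap forces
   [mu i - mu j >= delta]. *)
case: (leP c (mu i)) => ci; case: (leP c (mu j)) => cj;
  rewrite ?subrr ?subr0 ?sub0r ?mulrN ?mulr1 ?mulr0 ?sqr_ge0//; last first.
  by apply: le_trans (sqr_ge0 _); rewrite oppr_le0 sqr_ge0.
have := gap j; rewrite cj andbT -ltNge => cj'.
have : delta <= mu i - mu j.
  by move: ci; rewrite /c -natr1; lra.
by move=> h; rewrite ler_sqr ?nnegrE// ?(le_trans _ h)// ltW.
Qed.

(** Each [|mu i|^6] is at most [d^4 Q^2] by the cut bound, applied to the reversed flow when
    [mu i < 0]. The sum is at most [d] times its largest term, and cubing brings the factor
    [d^3]. *)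
Lemma net_flow_ineq d (w : 'I_d -> 'I_d -> R) (mu : 'I_d -> R) :
  (forall i j, 0 <= w i j) -> (forall i, mu i = \sum_j (w i j - w j i)) ->
  (\sum_i mu i ^+ 2) ^+ 3 <=
    d%:R ^+ 7 * (\sum_i \sum_j (mu i - mu j) ^+ 2 * w i j) ^+ 2.
Proof.
move=> w0 muE; set Q := \sum_i \sum_j _.
have Q0 : 0 <= Q.
  by apply: sumr_ge0 => i _; apply: sumr_ge0 => j _; rewrite mulr_ge0// sqr_ge0.
have bound i : (mu i ^+ 2) ^+ 3 <= d%:R ^+ 4 * Q ^+ 2.
  suff : `|mu i| ^+ 3 <= d%:R ^+ 2 * Q.
    move=> h; rewrite -real_normK ?num_real// -exprM (exprM _ 3 2) (exprM _ 2 2).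
    rewrite -exprMn ler_sqr ?nnegrE ?exprn_ge0// ?mulr_ge0// ?sqr_ge0//.
  have [m0|m0] := leP 0 (mu i); first by rewrite ger0_norm//; exact: net_flow_cut.
  rewrite ltr0_norm//.
  have -> : Q = \sum_i \sum_j (- mu i - - mu j) ^+ 2 * w j i.
    rewrite /Q exchange_big; apply: eq_bigr => k _; apply: eq_bigr => l _.
    by congr (_ * _); ring.
  apply: (net_flow_cut (mu := fun i => - mu i)) => //.
  - by move=> j; rewrite muE -sumrN; apply: eq_bigr => k _; rewrite opprB.
  - by rewrite oppr_ge0 ltW.
case: d w mu w0 muE @Q Q0 bound => [|d] w mu w0 muE Q Q0 bound.
  by rewrite big_ord0 expr0n mulr_ge0// ?sqr_ge0// exprn_ge0.
have [i _ imax] := Order.TotalTheory.arg_maxP (fun i => mu i ^+ 2) (erefl : xpredT (@ord0 d)).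
have : \sum_i mu i ^+ 2 <= d.+1%:R * mu i ^+ 2.
  rewrite -[d.+1 in leRHS]card_ord -sum1_card natr_sum mulr_suml.
  by apply: ler_sum => j _; rewrite mul1r; exact: imax.
move=> h; apply: (@le_trans _ _ ((d.+1%:R * mu i ^+ 2) ^+ 3)).
  rewrite ler_pXn2r// nnegrE.
    by apply: sumr_ge0 => j _; exact: sqr_ge0.
  by rewrite mulr_ge0// sqr_ge0.
rewrite exprMn [d.+1%:R ^+ 7](exprD _ 3 4) -mulrA ler_pM2l//.
Qed.

End NetFlow.

(** * The Lojasiewicz inequality for the energy *)

Section Lojasiewicz.

Local Open Scope sesquilinear_scope.
Local Open Scope complex_scope.

Context {R : realType} {d : nat}.
Local Notation C := R[i].
Local Notation Re := complex.Re.
Local Notation Im := complex.Im.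

Lemma mulC_conj (z : C) : z * z^* = (Re z ^+ 2 + Im z ^+ 2)%:C.
Proof. by case: z => a b; apply/eqP; rewrite eq_complex /=; apply/andP; split; apply/eqP; ring. Qed.

Section UnitaryConjugation.

Variable P : 'M[C]_d.
Hypothesis Pu : P \is unitarymx.
Let cj (X : 'M[C]_d) : 'M[C]_d := P *m X *m P^t*.

Let PP : P^t* *m P = 1%:M.
Proof. by apply: mulmx1C; apply/unitarymxP. Qed.

Let cjM X Y : cj X *m cj Y = cj (X *m Y).
Proof. by rewrite /cj !mulmxA -[_ *m P^t* *m P]mulmxA PP mulmx1. Qed.

Let cjB X Y : cj X - cj Y = cj (X - Y).
Proof. by rewrite /cj mulmxBr mulmxBl. Qed.

Lemma selfcomm_unitary_conj A : selfcomm (cj A) = cj (selfcomm A).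
Proof.
have adj : (cj A)^t* = cj (A^t*) by rewrite /cj !adjmxM trmxCK mulmxA.
by rewrite /selfcomm adj !cjM cjB.
Qed.

Lemma dblcomm_unitary_conj A : dblcomm (cj A) = cj (dblcomm A).
Proof. by rewrite /dblcomm selfcomm_unitary_conj !cjM cjB. Qed.

Lemma frob_inner_unitary_conj X Y : frob_inner (cj X) (cj Y) = frob_inner X Y.
Proof.
by rewrite /cj frob_inner_mulr trmxCK -mulmxA PP mulmx1 frob_inner_mull
           mulmxA PP mul1mx.
Qed.

End UnitaryConjugation.

(** [A A^*] contributes the weights [|a_ij|^2] of row [i] and [A^* A] those of column [i]: the
    difference is the net outflow at [i]. *)
Lemma selfcomm_diag (A : 'M[C]_d) i : selfcomm A i i =
  (\sum_j ((Re (A i j) ^+ 2 + Im (A i j) ^+ 2) -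
           (Re (A j i) ^+ 2 + Im (A j i) ^+ 2)))%:C.
Proof.
rewrite !mxE rmorph_sum /= -sumrB; apply: eq_bigr => j _.
by rewrite !mxE rmorphB /= -!mulC_conj [X in _ - X]mulrC.
Qed.

(** For diagonal [M] the entries of [[M, A]] are [(mu i - mu j) a_ij], so this is the net flow
    inequality. *)
Lemma lojasiewicz_of_diag (A : 'M[C]_d) : is_diag_mx (selfcomm A) ->
  nonnormality A ^+ 3 <=
    d%:R ^+ 7 * frob_inner (dblcomm A) (dblcomm A) ^+ 2.
Proof.
move=> /is_diag_mxP Adiag.
pose w i j := Re (A i j) ^+ 2 + Im (A i j) ^+ 2.
pose mu i := \sum_j (w i j - w j i).
have selfE i j : selfcomm A i j = (if i == j then mu i else 0)%:C.
  by case: eqVneq => [<-|ij]; [exact: selfcomm_diag | rewrite Adiag].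
have -> : nonnormality A = \sum_i mu i ^+ 2.
  rewrite nonnormalityE frob_innerE; apply: eq_bigr => i _.
  rewrite (bigD1 i)//= big1 => [|j]; first by rewrite selfE eqxx /=; ring.
  by rewrite eq_sym selfE => /negPf -> /=; ring.
have -> : frob_inner (dblcomm A) (dblcomm A) =
    \sum_i \sum_j (mu i - mu j) ^+ 2 * w i j.
  rewrite frob_innerE; apply: eq_bigr => i _; apply: eq_bigr => j _.
  have -> : dblcomm A i j = (mu i - mu j)%:C * A i j.
    rewrite /dblcomm mxE [X in _ + X]mxE [X in X + _]mxE [X in _ - X]mxE.
    rewrite (bigD1 i)//= big1 => [|k]; last first.
      by rewrite eq_sym selfE => /negPf ->; rewrite mul0r.
    rewrite (bigD1 j)//= big1 => [|k]; last first.
      by rewrite selfE => /negPf ->; rewrite mulr0.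
    by rewrite !selfE !eqxx !addr0 rmorphB mulrBl [A i j * _]mulrC.
  by rewrite /w; case: (A i j) => a b /=; ring.
apply: net_flow_ineq => // i j.
by rewrite addr_ge0// sqr_ge0.
Qed.

(** [M] is Hermitian, so a unitary conjugation makes it diagonal, and both sides are invariant. *)
Lemma selfcomm_lojasiewicz (A : cmat R d) :
  nonnormality A ^+ 3 <=
    d%:R ^+ 7 * frob_inner (dblcomm A) (dblcomm A) ^+ 2.
Proof.
have Mnormal : selfcomm A \is normalmx by apply/normalmxP; rewrite selfcomm_adj.
have Pu := spectral_unitarymx (selfcomm A); set P := spectralmx _ in Pu.
have := lojasiewicz_of_diag (A := P *m A *m P^t*).
rewrite !nonnormalityE selfcomm_unitary_conj// dblcomm_unitary_conj//.
rewrite !frob_inner_unitary_conj//; apply.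
rewrite {1}(orthomx_spectralP Mnormal) -/P invmx_unitary// !mulmxA.
rewrite (unitarymxP Pu) mul1mx -mulmxA (unitarymxP Pu) mulmx1.
exact: diag_mx_is_diag.
Qed.

End Lojasiewicz.

(** * Monotonicity, Gronwall and limits on a half-line *)

Section HalfLineCalculus.

Context {R : realType}.

Lemma ler0_is_derive (f df : R -> R) (T : R) :
  (forall t : R, T <= t -> is_derive t 1 f (df t)) ->
  (forall t : R, T <= t -> df t <= 0) ->
  forall s t : R, T <= s -> s <= t -> f t <= f s.
Proof.
move=> fd df0 s t Ts; rewrite le_eqVlt => /orP[/eqP ->//|st].
have [x||c] := @MVT R f df s t st.
- by rewrite in_itv /= => /andP[/ltW sx _]; apply: fd; exact: le_trans sx.
- apply: derivable_within_continuous => x.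
  by rewrite in_itv /= => /andP[sx _]; have [] := fd x (le_trans Ts sx).
- rewrite in_itv /= => /andP[/ltW sc _] E.
  rewrite -subr_le0 E; apply: mulr_le0_ge0; last by rewrite subr_ge0 ltW.
  by apply: df0; exact: le_trans sc.
Qed.

Lemma ger0_is_derive (f df : R -> R) (T : R) :
  (forall t : R, T <= t -> is_derive t 1 f (df t)) ->
  (forall t : R, T <= t -> 0 <= df t) ->
  forall s t : R, T <= s -> s <= t -> f s <= f t.
Proof.
move=> fd df0 s t Ts st; rewrite -lerN2.
apply: (@ler0_is_derive (- f) (- df) T) => // x Tx.
- by have := fd x Tx; exact: is_deriveN.
- by rewrite oppr_le0 df0.
Qed.

(** [Y(t) exp(- K t)] is nonincreasing, nonnegative and starts at [0]. *)
Lemma gronwall_eq0 (Y dY : R -> R) (K : R) :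
  (forall t : R, 0 <= t -> is_derive t 1 Y (dY t)) ->
  (forall t : R, 0 <= t -> dY t <= K * Y t) ->
  (forall t : R, 0 <= t -> 0 <= Y t) -> Y 0 = 0 ->
  forall t : R, 0 <= t -> Y t = 0.
Proof.
move=> Yd dYK Y0 Y00 t t0; apply/eqP; rewrite eq_le Y0// andbT.
pose g s := Y s * expR (- K * s).
pose dg s := (dY s - K * Y s) * expR (- K * s).
have gd (s : R) : 0 <= s -> is_derive s 1 g (dg s).
  move=> s0; have Ys := Yd s s0.
  have dK : is_derive s 1 (fun x : R => - K * x) (- K).
    by have := is_deriveZ (- K) (is_derive_id s (1 : R)); rewrite /GRing.scale /= mulr1.
  have dexp : is_derive s 1 (fun x => expR (- K * x)) (expR (- K * s) * - K).
    exact: (is_derive1_comp (is_derive_expR _) dK).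
  have := is_deriveM Ys dexp; rewrite /GRing.scale /=.
  by move=> h; apply: is_derive_eq h _; rewrite /dg; ring.
have : g t <= g 0.
  apply: (ler0_is_derive gd) => // s s0.
  by rewrite mulr_le0_ge0 ?expR_ge0// subr_le0 dYK.
by rewrite /g Y00 mul0r pmulr_lle0// expR_gt0.
Qed.

Lemma nonincreasing_ge_cvg (f : R -> R) (T m : R) :
  (forall s t : R, T <= s -> s <= t -> f t <= f s) ->
  (forall t : R, T <= t -> m <= f t) ->
  exists l : R, f t @[t --> +oo] --> l.
Proof.
(* Freezing [f] before [T] makes it monotone on the whole line; the sign makes it nondecreasing. *)
move=> fmono fm; pose g t := - f (Num.max T t).
have gmono : {homo g : x y / x <= y}.
  move=> x y xy; rewrite lerN2; apply: fmono; first by rewrite le_max lexx.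
  by rewrite ge_max !le_max lexx xy orbT.
have gub : has_ubound (range g).
  by exists (- m) => _ [x _ <-]; rewrite lerN2 fm// le_max lexx.
exists (- sup (range g)).
apply: cvg_trans (cvgN (nondecreasing_cvgr gmono gub)).
apply: near_eq_cvg; near=> t.
have Tt : T <= t by near: t; exact: nbhs_pinfty_ge (num_real T).
by rewrite /g !fctE opprK max_r.
Unshelve. all: by end_near.
Qed.

End HalfLineCalculus.

(** * Lipschitz bounds on the sphere *)

Section Lipschitz.

Local Open Scope sesquilinear_scope.
Local Open Scope complex_scope.

Context {R : realType} {d : nat}.
Local Notation C := R[i].
Implicit Types A B : cmat R d.

Lemma subrACA (V : zmodType) (x y z t : V) :
  (x - y) - (z - t) = (x - z) - (y - t).
Proof. by rewrite !opprD !opprK addrACA. Qed.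

Lemma mulmx_lipschitz (A B A' B' : 'M[C]_d) :
  `|(A *m A' - B *m B' : cmat R d)| <=
  `|(A - B : cmat R d)| * `|(A' : cmat R d)| +
  `|(B : cmat R d)| * `|(A' - B' : cmat R d)|.
Proof.
have -> : (A *m A' - B *m B' : cmat R d) =
          ((A - B) *m A' : cmat R d) + (B *m (A' - B') : cmat R d).
  by rewrite mulmxBl mulmxBr addrA subrK.
by apply: le_trans (ler_normD _ _) _; apply: lerD; exact: cmat_normM.
Qed.

Lemma selfcomm_lipschitz A B : `|A| = 1 -> `|B| = 1 ->
  `|(selfcomm A - selfcomm B : cmat R d)| <= 4 * `|A - B|.
Proof.
move=> A1 B1.
have adjB : `|((A : 'M[C]_d)^t* - (B : 'M[C]_d)^t* : cmat R d)| = `|A - B|.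
  by rewrite -adjmxB; exact: cmat_norm_adj.
have h1 := mulmx_lipschitz (A : 'M[C]_d) (B : 'M[C]_d) ((A : 'M[C]_d)^t*) ((B : 'M[C]_d)^t*).
have h2 := mulmx_lipschitz ((A : 'M[C]_d)^t*) ((B : 'M[C]_d)^t*) (A : 'M[C]_d) (B : 'M[C]_d).
rewrite !adjB !cmat_norm_adj !A1 !B1 in h1 h2.
have -> : (selfcomm A - selfcomm B : cmat R d) =
  ((A : 'M[C]_d) *m A^t* - (B : 'M[C]_d) *m B^t* : cmat R d) -
  (A^t* *m (A : 'M[C]_d) - B^t* *m (B : 'M[C]_d) : cmat R d).
  exact: (@subrACA (cmat R d)).
apply: le_trans (ler_normB _ _) _.
move: h1 h2; lra.
Qed.

Lemma selfcomm_le A : `|A| = 1 -> `|(selfcomm A : cmat R d)| <= 2.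
Proof.
move=> A1; apply: le_trans (ler_normB _ _) _.
have := cmat_normM (A : 'M[C]_d) ((A : 'M[C]_d)^t*).
have := cmat_normM ((A : 'M[C]_d)^t*) (A : 'M[C]_d).
by rewrite cmat_norm_adj A1; lra.
Qed.

(** Each of the two products costs [4 + 2]: the Lipschitz constant of [selfcomm] and its bound. *)
Lemma dblcomm_lipschitz A B : `|A| = 1 -> `|B| = 1 ->
  `|(dblcomm A - dblcomm B : cmat R d)| <= 12 * `|A - B|.
Proof.
move=> A1 B1.
have h1 := mulmx_lipschitz (selfcomm A) (selfcomm B) (A : 'M[C]_d) (B : 'M[C]_d).
have h2 := mulmx_lipschitz (A : 'M[C]_d) (B : 'M[C]_d) (selfcomm A) (selfcomm B).
rewrite A1 B1 in h1 h2.
have -> : (dblcomm A - dblcomm B : cmat R d) =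
  (selfcomm A *m A - selfcomm B *m B : cmat R d) -
  ((A : 'M[C]_d) *m selfcomm A - (B : 'M[C]_d) *m selfcomm B : cmat R d).
  exact: (@subrACA (cmat R d)).
apply: le_trans (ler_normB _ _) _; apply: le_trans (lerD h1 h2) _.
have sA := ler_wpM2l (normr_ge0 (A - B)) (selfcomm_le A1).
have sB := ler_wpM2r (normr_ge0 (A - B)) (selfcomm_le B1).
have sAB := selfcomm_lipschitz A1 B1.
rewrite mul1r mulr1; apply: le_trans (lerD (lerD sAB sB) (lerD sA sAB)) _.
by rewrite le_eqVlt; apply/orP; left; apply/eqP; ring.
Qed.

(** Splitting [E(A) A - E(B) B] as [E(A) (A - B) + (E(A) - E(B)) B] gives [4 (12 + 4 + 16)]. The
    bound serves to compare a trajectory with its conjugate. *)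
Lemma sphere_grad_lipschitz A B : unit_sphere A -> unit_sphere B ->
  `|sphere_grad A - sphere_grad B| <= 128 * `|A - B|.
Proof.
rewrite /unit_sphere /= => A1 B1.
have dAB := dblcomm_lipschitz A1 B1.
set a := `|(selfcomm A : cmat R d)|; set b := `|(selfcomm B : cmat R d)|.
have -> : sphere_grad A - sphere_grad B =
  4 *: ((dblcomm A - dblcomm B : cmat R d) -
        (a ^+ 2 *: (A - B) + (a ^+ 2 - b ^+ 2) *: B)).
  rewrite /sphere_grad -scalerBr; congr (_ *: _).
  by rewrite scalerBr scalerBl addrA subrK; exact: subrACA.
have a0 : 0 <= a := normr_ge0 _.
have b0 : 0 <= b := normr_ge0 _.
have a2 : a <= 2 by exact: selfcomm_le.
have b2 : b <= 2 by exact: selfcomm_le.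
have ab : `|a - b| <= 4 * `|A - B|.
  exact: le_trans (ler_dist_dist _ _) (selfcomm_lipschitz A1 B1).
have n1 : `|a ^+ 2 *: (A - B)| <= 4 * `|A - B|.
  rewrite normrZ ler_wpM2r// ger0_norm ?sqr_ge0//.
  apply: (@le_trans _ _ (2 ^+ 2)); first by rewrite ler_sqr ?nnegrE ?normr_ge0.
  by rewrite expr2; lra.
have n2 : `|(a ^+ 2 - b ^+ 2) *: B| <= 16 * `|A - B|.
  rewrite normrZ B1 mulr1 subr_sqr normrM.
  have ab4 : `|a + b| <= 4 by rewrite ger0_norm; lra.
  by apply: le_trans (ler_pM (normr_ge0 _) (normr_ge0 _) ab ab4) _; lra.
rewrite normrZ ger0_norm//.
have := ler_normB (dblcomm A - dblcomm B : cmat R d)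
   (a ^+ 2 *: (A - B) + (a ^+ 2 - b ^+ 2) *: B).
have := ler_normD (a ^+ 2 *: (A - B)) ((a ^+ 2 - b ^+ 2) *: B).
lra.
Qed.

End Lipschitz.

(** * Decay of the energy and growth of the traces *)

Section FlowEstimates.

Local Open Scope sesquilinear_scope.
Local Open Scope complex_scope.

Context {R : realType} {d : nat}.
Local Notation C := R[i].
Local Notation Re := complex.Re.
Local Notation Im := complex.Im.

Variable A : R -> cmat R d.
Hypothesis flowA : is_sphere_flow A.

Local Notation E t := (nonnormality (A t)).

Let sphereA t : 0 <= t -> unit_sphere (A t).
Proof. by move=> /flowA[]. Qed.

Let normA t : 0 <= t -> `|A t| = 1.
Proof. exact: sphereA. Qed.

Lemma flow_mxderive (t : R) : 0 <= t ->
  is_mxderive A t (- sphere_grad (A t) : cmat R d).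
Proof. by move=> /flowA[_]; exact: is_derive_mxderive. Qed.

Lemma sphere_grad_orthogonal (B : cmat R d) :
  unit_sphere B -> frob_inner (sphere_grad B) B = 0.
Proof.
move=> /unit_sphereE B1.
rewrite /sphere_grad frob_innerZl frob_innerBl frob_innerZl B1 mulr1.
by rewrite frob_inner_dblcomm nonnormalityE subrr mulr0.
Qed.

Lemma sphere_grad_dblcomm (B : cmat R d) : unit_sphere B ->
  `|sphere_grad B| ^+ 2 = 4 * frob_inner (dblcomm B) (sphere_grad B).
Proof.
move=> SB; rewrite cmat_sqr_norm {1}/sphere_grad frob_innerZl frob_innerBl.
by rewrite frob_innerZl [frob_inner B _]frob_innerC sphere_grad_orthogonal//
           mulr0 subr0.
Qed.

(** Pythagoras: [4 [M, B]] is the gradient plus the orthogonal radial part [4 E B], and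
    [|B| = 1]. *)
Lemma sphere_grad_sqnorm (B : cmat R d) : unit_sphere B ->
  `|sphere_grad B| ^+ 2 =
    16 * (frob_inner (dblcomm B) (dblcomm B) - nonnormality B ^+ 2).
Proof.
move=> SB; rewrite sphere_grad_dblcomm// /sphere_grad frob_innerZr frob_innerBr.
by rewrite frob_innerZr frob_inner_dblcomm -nonnormalityE; ring.
Qed.

Lemma energy_derive (t : R) : 0 <= t ->
  is_derive t 1 (fun s => E s) (- `|sphere_grad (A t)| ^+ 2).
Proof.
move=> t0; have := is_derive_nonnormality (flow_mxderive t0).
move=> h; apply: is_derive_eq h _.
by rewrite frob_innerNr mulrN -sphere_grad_dblcomm//; exact: sphereA.
Qed.

Lemma energy_nonincreasing (s t : R) : 0 <= s -> s <= t -> E t <= E s.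
Proof.
apply: (ler0_is_derive (@energy_derive)) => u _.
by rewrite oppr_le0 sqr_ge0.
Qed.

Lemma energy_ge0 (t : R) : 0 <= E t.
Proof. exact: sqr_ge0. Qed.

Lemma sphere_gradN_mx (B : cmat R d) : (- sphere_grad B : 'M[C]_d) =
  (4 * nonnormality B)%:C *: (B : 'M[C]_d) - 4%:C *: dblcomm B.
Proof.
rewrite /sphere_grad -scalerN opprB scalerBr scalerA.
by [].
Qed.

Lemma ReMreal (x : R) (z : C) : Re (x%:C * z) = x * Re z.
Proof. by case: z => a b /=; rewrite mul0r subr0. Qed.

Lemma ImMreal (x : R) (z : C) : Im (x%:C * z) = x * Im z.
Proof. by case: z => a b /=; rewrite mul0r addr0. Qed.

(** The commutator with [M] is a derivation, so the commutator terms combine and the radial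
    coefficients add. *)
Lemma leibniz_commutator (x y z : C) (M a b : 'M[C]_d) :
  (x *: b - z *: (M *m b - b *m M)) *m a +
    b *m (y *: a - z *: (M *m a - a *m M)) =
  (x + y) *: (b *m a) - z *: (M *m (b *m a) - (b *m a) *m M).
Proof.
rewrite mulmxBl mulmxBr -!scalemxAl -!scalemxAr mulmxBl mulmxBr !mulmxA.
by rewrite addrACA -scalerDl -opprD -scalerDr addrA subrK.
Qed.

(* The unnormalised flow is by conjugation, so it does not change the traces of
   powers; only the radial term [4 E A] does. *)
Lemma flow_pow_mxderive (t : R) k : 0 <= t ->
  is_mxderive (fun s => (A s : 'M[C]_d) ^+ k) t
   ((4 * k%:R * E t)%:C *: (A t : 'M[C]_d) ^+ k -
    4%:C *: (selfcomm (A t) *m (A t : 'M[C]_d) ^+ k -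
             (A t : 'M[C]_d) ^+ k *m selfcomm (A t))).
Proof.
move=> t0; elim: k => [|k IH].
  rewrite !expr0 mulr0 mul0r scale0r sub0r mulmx1 mul1mx subrr scaler0 oppr0.
  exact: is_mxderive_cst.
have := is_mxderiveM IH (flow_mxderive t0).
under [X in is_mxderive X _ _ -> _]eq_fun do rewrite mulmxE -exprSr.
rewrite sphere_gradN_mx /dblcomm exprSr -mulmxE.
rewrite leibniz_commutator -rmorphD.
move=> h; have -> : 4 * k.+1%:R * E t = 4 * k%:R * E t + 4 * nonnormality (A t).
  by rewrite -natr1; ring.
exact: h.
Qed.

Let p k s := \tr ((A s : 'M[C]_d) ^+ k).
Let q k s := Re (p k s) ^+ 2 + Im (p k s) ^+ 2.

(** Commutators have trace zero, so [p' = 4 k E p]; the squared modulus [q] grows at twice that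
    rate. *)
Lemma trace_pow_derive (t : R) k : 0 <= t ->
  is_derive t 1 (q k) (8 * k%:R * E t * q k t).
Proof.
move=> t0; have := is_cderive_trace (flow_pow_mxderive k t0).
rewrite raddfB /= !mxtraceZ raddfB /= [X in _ - _ * (X - _)]mxtrace_mulC subrr.
rewrite mulr0 subr0 -/(p k t) => -[dRe dIm].
have -> : q k = (fun s => Re (p k s)) * (fun s => Re (p k s)) +
                (fun s => Im (p k s)) * (fun s => Im (p k s)).
  by apply/funext => s; rewrite /q !fctE !expr2.
have := is_deriveD (is_deriveM dRe dRe) (is_deriveM dIm dIm).
move=> h; apply: is_derive_eq h _.
rewrite !fctE /GRing.scale /= ReMreal ImMreal /p; ring.
Qed.

(** Positive powers of [A t] have norm at most [1], and the two parts of the trace are pairings with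
    the scalar matrices [1] and ['i]. *)
Lemma trace_pow_bounded k : exists K : R, forall t : R, 0 <= t -> q k.+1 t <= K.
Proof.
exists (`|(1%:M : cmat R d)| ^+ 2 + `|('i%:M : cmat R d)| ^+ 2) => t t0.
have powA : `|((A t : 'M[C]_d) ^+ k.+1 : cmat R d)| <= 1.
  elim: k => [|k IH]; first by rewrite expr1 normA.
  rewrite exprSr -mulmxE; apply: le_trans (cmat_normM _ _) _.
  by rewrite normA// mulr1.
set B : cmat R d := (A t : 'M[C]_d) ^+ k.+1 in powA.
have -> : q k.+1 t = frob_inner B (1%:M : 'M[C]_d) ^+ 2 +
                     frob_inner B ('i%:M : 'M[C]_d) ^+ 2.
  rewrite /q /p -/B /frob_inner.
  have adjs (z : C) : (z%:M : 'M[C]_d)^t* = (z^*)%:M.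
    by rewrite tr_scalar_mx map_scalar_mx.
  rewrite !adjs !mul_scalar_mx !mxtraceZ.
  by case: (\tr B) => x y /=; congr (_ ^+ 2 + _ ^+ 2); ring.
have inner_le (W : cmat R d) : frob_inner B W ^+ 2 <= `|W| ^+ 2.
  rewrite -real_normK ?num_real// ler_sqr ?nnegrE//.
  by apply: le_trans (frob_inner_le_norm _ _) _; rewrite ler_piMl.
exact: lerD.
Qed.

(** If [E] stayed above [e], then [q k.+1] would grow at rate at least [c = 8 e q(0) > 0] and exceed
    its bound [K] at time [K / c]. *)
Lemma energy_small k : \tr ((A 0 : 'M[C]_d) ^+ k.+1) <> 0 ->
  forall e : R, 0 < e -> exists2 T : R, 0 <= T & forall t, T <= t -> E t <= e.
Proof.
move=> tr0 e e0; apply: contrapT => noT.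
have Ebig (t : R) : 0 <= t -> e < E t.
  move=> t0; rewrite ltNge; apply/negP => Et; apply: noT.
  exists t; first exact: t0.
  by move=> s ts; exact: le_trans (energy_nonincreasing t0 ts) Et.
have q_ge0 t : 0 <= q k.+1 t by rewrite addr_ge0// sqr_ge0.
have q0 : 0 < q k.+1 0.
  rewrite lt_neqAle q_ge0 andbT eq_sym; apply/eqP => /eqP.
  rewrite paddr_eq0 ?sqr_ge0// !sqrf_eq0 => /andP[/eqP re0 /eqP im0].
  by apply: tr0; rewrite -/(p k.+1 0); case: (p k.+1 0) re0 im0 => x y /= -> ->.
have qmono (s t : R) : 0 <= s -> s <= t -> q k.+1 s <= q k.+1 t.
  apply: (ger0_is_derive (fun t t0 => trace_pow_derive k.+1 t0)) => u u0.
  apply: mulr_ge0 (q_ge0 _); apply: mulr_ge0 (energy_ge0 _).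
  by rewrite mulr_ge0 ?ler0n.
have [K qK] := trace_pow_bounded k.
pose c := 8 * e * q k.+1 0.
have c0 : 0 < c by rewrite /c (mulr_gt0 _ q0) ?(mulr_gt0 _ e0) ?ltr0n.
pose h s := q k.+1 s - c * s.
have hd (t : R) : 0 <= t ->
    is_derive t 1 h (8 * k.+1%:R * E t * q k.+1 t - c).
  move=> t0; have := trace_pow_derive k.+1 t0 => dq.
  have dc : is_derive t 1 (fun x : R => c * x) c.
    by have := is_deriveZ c (is_derive_id t (1 : R)); rewrite /GRing.scale /= mulr1.
  exact: (is_deriveB dq dc).
have K0 : 0 <= K := le_trans (q_ge0 0) (qK 0 (lexx _)).
have Kc : 0 <= K / c := divr_ge0 K0 (ltW c0).
have cK : c * (K / c) = K by rewrite mulrC (divfK (lt0r_neq0 c0)).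
have : h 0 <= h (K / c).
  apply: (ger0_is_derive hd _ (lexx _) Kc) => u u0; rewrite subr_ge0 /c.
  apply: ler_pM; last exact: (qmono _ _ (lexx _) u0).
  - by rewrite mulr_ge0 ?ler0n ?(ltW e0).
  - exact: ltW q0.
  rewrite -mulrA ler_pM2l ?ltr0n//; apply: le_trans (ltW (Ebig u u0)) _.
  by apply: ler_peMl (energy_ge0 _) _; rewrite ler1n.
have -> : h 0 = q k.+1 0.
  exact: etrans (congr1 (fun z => q k.+1 0 - z) (mulr0 c)) (subr0 _).
have -> : h (K / c) = q k.+1 (K / c) - K.
  exact (congr1 (fun z : R => q k.+1 (K / c) - z) cK).
by move=> /(lt_le_trans q0); rewrite subr_gt0 ltNge (qK _ Kc).
Qed.

End FlowEstimates.

(** * Finite length and convergence of the trajectory *)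

Section FlowLimit.

Local Open Scope sesquilinear_scope.
Local Open Scope complex_scope.

Context {R : realType} {d : nat}.
Local Notation C := R[i].
Local Notation Re := complex.Re.
Local Notation Im := complex.Im.

Lemma cvgr_sum_pinfty (I : Type) (s : seq I) (f : I -> R -> R) (l : I -> R) :
  (forall i, f i t @[t --> +oo] --> l i) ->
  \sum_(i <- s) f i t @[t --> +oo] --> \sum_(i <- s) l i.
Proof.
move=> fl; elim: s => [|i s IH].
  by rewrite big_nil; under eq_fun do rewrite big_nil; exact: cvg_cst.
by rewrite big_cons; under eq_fun do rewrite big_cons; exact: cvgD (fl i) IH.
Qed.

(** Weak convergence suffices in finite dimension: entries are pairings with elementary matrices,
    and the squared distance to the entrywise limit is a finite sum. *)
Lemma cvg_of_frob_inner (A : R -> cmat R d) :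
  (forall W, exists l : R, frob_inner (A t) W @[t --> +oo] --> l) ->
  exists L : cmat R d, A t @[t --> +oo] --> L.
Proof.
move=> Acvg.
have /choice[re reP] : forall ij : 'I_d * 'I_d, exists l : R,
    Re (A t ij.1 ij.2) @[t --> +oo] --> l.
  move=> ij; have [l Al] := Acvg (1 *: delta_mx ij.1 ij.2 : 'M[C]_d).
  by exists l; under eq_fun do rewrite Re_entry.
have /choice[im imP] : forall ij : 'I_d * 'I_d, exists l : R,
    Im (A t ij.1 ij.2) @[t --> +oo] --> l.
  move=> ij; have [l Al] := Acvg ('i *: delta_mx ij.1 ij.2 : 'M[C]_d).
  by exists l; under eq_fun do rewrite Im_entry.
pose L : cmat R d := (\matrix_(i, j) (re (i, j) +i* im (i, j)) : 'M[C]_d).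
exists L.
pose g i j t := (Re (A t i j) - re (i, j)) ^+ 2 + (Im (A t i j) - im (i, j)) ^+ 2.
have gcvg i j : g i j t @[t --> +oo] --> (0 : R).
  have reB : Re (A t i j) - re (i, j) @[t --> +oo] --> (0 : R).
    by rewrite -(subrr (re (i, j))); apply: cvgB (cvg_cst _); exact: (reP (i, j)).
  have imB : Im (A t i j) - im (i, j) @[t --> +oo] --> (0 : R).
    by rewrite -(subrr (im (i, j))); apply: cvgB (cvg_cst _); exact: (imP (i, j)).
  have := cvgD (cvgM reB reB) (cvgM imB imB); rewrite !mulr0 addr0 => h.
  have -> : g i j = (fun t => (Re (A t i j) - re (i, j)) * (Re (A t i j) - re (i, j)) +
      (Im (A t i j) - im (i, j)) * (Im (A t i j) - im (i, j))).
    by apply/funext => t; rewrite /g !expr2.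
  exact: h.
have sq_cvg : frob_inner (A t - L) (A t - L) @[t --> +oo] --> (0 : R).
  have -> : (fun t => frob_inner (A t - L) (A t - L)) =
    (fun t => \sum_i \sum_j g i j t).
    apply/funext => t; rewrite frob_innerE.
    apply: eq_bigr => i _; apply: eq_bigr => j _.
    by rewrite /g !mxE; case: (A t i j) => x y /=; rewrite !expr2.
  have row_cvg i := @cvgr_sum_pinfty _ (index_enum 'I_d) (g i) (fun=> 0) (gcvg i).
  have := @cvgr_sum_pinfty _ (index_enum 'I_d) (fun i t => \sum_j g i j t)
    (fun=> \sum_(j < d) 0) row_cvg.
  have s0 : \sum_(i < d) \sum_(j < d) (0 : R) = 0.
    by rewrite big1// => i _; rewrite big1.
  by rewrite s0.
apply/cvgrPdist_lt => e e0.
have e2 : 0 < e ^+ 2 by rewrite exprn_gt0.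
move/cvgrPdist_lt : sq_cvg => /(_ _ e2).
apply: filterS => t; rewrite sub0r normrN ger0_norm ?frob_inner_ge0//.
by rewrite -cmat_sqr_norm ltr_sqr ?nnegrE ?(ltW e0)// distrC.
Qed.

(** To be used with [r = E^(1/4)], [Q = |[M, A]|^2], [g = |grad E|] and [D = d^7]; the final
    right-hand side is minus the derivative of [2 D r] along the flow. *)
Lemma lojasiewicz_gradient (r D Q g : R) : 0 < r -> 1 <= D -> 0 <= Q ->
  (r ^+ 4) ^+ 3 <= D * Q ^+ 2 -> r ^+ 4 <= (2 * D)^-1 ^+ 2 ->
  0 <= g -> g ^+ 2 = 16 * (Q - (r ^+ 4) ^+ 2) ->
  g <= 2 * D * (g ^+ 2 / (4 * r ^+ 3)).
Proof.
move=> r0 D1 Q0 loj small g0 gE.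
have D0 : 0 < D by exact: lt_le_trans D1.
have [r_ge0 D_ge0] := (ltW r0, ltW D0).
have rQ : r ^+ 6 <= D * Q.
  rewrite -ler_sqr ?nnegrE ?exprn_ge0 ?mulr_ge0//.
  have -> : (r ^+ 6) ^+ 2 = (r ^+ 4) ^+ 3 by rewrite -!exprM.
  apply: le_trans loj _; rewrite exprMn.
  by rewrite ler_wpM2r ?sqr_ge0// expr2 ler_peMl.
have r2 : r ^+ 2 <= (2 * D)^-1.
  rewrite -ler_sqr ?nnegrE ?exprn_ge0 ?invr_ge0 ?mulr_ge0//.
  by rewrite -exprM.
(* Small energy: the term [E^2] costs at most half of [r ^+ 6], which leaves [D g^2 >= 8 r^6]. *)
have r8 : 2 * D * (r ^+ 4) ^+ 2 <= r ^+ 6.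
  rewrite -exprM [in leLHS](exprD r 2 6) mulrA -[leRHS]mul1r.
  rewrite ler_wpM2r ?exprn_ge0//.
  have D20 : 0 < 2 * D by rewrite mulr_gt0.
  by rewrite mulrC -ler_pdivlMr// mul1r.
have r6 : 0 < r ^+ 6 by rewrite exprn_gt0.
have Dg : r ^+ 6 * 8 <= D * g ^+ 2.
  by rewrite gE; move: rQ r8; set x := _ ^+ 2; lra.
have key : 4 * r ^+ 3 <= 2 * D * g.
  rewrite -ler_sqr ?nnegrE ?mulr_ge0// ?exprn_ge0//.
  have -> : (4 * r ^+ 3) ^+ 2 = 16 * r ^+ 6 by ring.
  have -> : (2 * D * g) ^+ 2 = 4 * D * (D * g ^+ 2) by ring.
  apply: (@le_trans _ _ (4 * (r ^+ 6 * 8))); first by lra.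
  rewrite -mulrA ler_pM2l//; apply: le_trans Dg _.
  by rewrite ler_peMl// mulr_ge0 ?sqr_ge0.
have r3 : 0 < 4 * r ^+ 3 by rewrite mulr_gt0// exprn_gt0.
rewrite mulrA ler_pdivlMr// expr2 mulrA [leRHS]mulrC.
by rewrite ler_wpM2l.
Qed.

Variable A : R -> cmat R d.
Hypothesis flowA : is_sphere_flow A.

Lemma sphere_grad_eq0 (B : cmat R d) :
  nonnormality B = 0 -> sphere_grad B = 0.
Proof.
move=> B0; have M0 : selfcomm B = 0.
  by apply/frob_inner_eq0; rewrite -nonnormalityE.
by rewrite /sphere_grad B0 /dblcomm M0 mul0mx mulmx0 scale0r !subrr scaler0.
Qed.

(* [u = c E^(1/4)]: by the inequality [|grad E| >= c' E^(3/4)] its decrease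
   bounds the length of the trajectory. *)
Lemma exists_length_bound : (0 < d)%N ->
  (forall e : R, 0 < e ->
     exists2 T : R, 0 <= T & forall t, T <= t -> nonnormality (A t) <= e) ->
  exists (T : R) (u du : R -> R), 0 <= T /\ forall t : R, T <= t ->
    [/\ is_derive t 1 u (du t), 0 <= u t & `|sphere_grad (A t)| <= - du t].
Proof.
move=> d0 Esmall.
(* Once the energy vanishes the gradient is zero from then on, and so is the length bound; otherwise
   [E > 0] throughout and its fourth root is differentiable. *)
have [[t1 t10 E0]|Epos] :=
    pselect (exists2 t1 : R, 0 <= t1 & nonnormality (A t1) = 0).
  exists t1, (cst 0), (cst 0); split; first exact: t10.
  move=> t tt1; split; [exact: is_derive_cst | exact: lexx |].
  have Et : nonnormality (A t) = 0.
    apply/eqP; rewrite eq_le (energy_ge0 A t) andbT -E0.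
    exact: energy_nonincreasing flowA _ _ t10 tt1.
  by rewrite (sphere_grad_eq0 Et) normr0 /cst oppr0.
have {}Epos t : 0 <= t -> 0 < nonnormality (A t).
  move=> t0; rewrite lt_neqAle eq_sym (energy_ge0 A) andbT; apply/eqP => Et.
  by apply: Epos; exists t.
pose D : R := d%:R ^+ 7.
have D1 : 1 <= D by rewrite exprn_ege1// ler1n.
have e0 : 0 < (2 * D)^-1 ^+ 2.
  by rewrite exprn_gt0// invr_gt0 mulr_gt0// (lt_le_trans _ D1).
have [T T0 ET] := Esmall _ e0.
pose r t := Num.sqrt (Num.sqrt (nonnormality (A t))).
pose g t := `|sphere_grad (A t)|.
exists T, (fun t => 2 * D * r t), (fun t => 2 * D * - (g t ^+ 2 / (4 * r t ^+ 3))).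
split; first exact: T0.
move=> t Tt; have t0 : 0 <= t by exact: le_trans Tt.
have {Epos} E0 := Epos t t0.
have sE0 : 0 < Num.sqrt (nonnormality (A t)) by rewrite sqrtr_gt0.
have r0 : 0 < r t by rewrite sqrtr_gt0.
have r2 : r t ^+ 2 = Num.sqrt (nonnormality (A t)).
  exact: sqr_sqrtr (ltW sE0).
have r4 : r t ^+ 4 = nonnormality (A t).
  by rewrite (exprM _ 2 2) r2; exact: sqr_sqrtr (ltW E0).
split.
- have dE := energy_derive flowA t0.
  have d1 := is_derive1_comp (f := Num.sqrt)
    (g := fun s => nonnormality (A s)) (is_derive1_sqrt E0) dE.
  have d2 := is_derive1_comp (f := Num.sqrt)
    (g := Num.sqrt \o (fun s => nonnormality (A s))) (is_derive1_sqrt sE0) d1.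
  have d3 := is_deriveZ (2 * D) d2.
  apply: is_derive_eq d3 _; rewrite -/(r t) -/(g t) -r2 /GRing.scale /=.
  by have := lt0r_neq0 r0; move: (r t) (g t) (2 * D) => x y z x0; field.
- apply: mulr_ge0 (ltW r0); apply: mulr_ge0 (le_trans ler01 D1).
  exact: ler0n.
- rewrite mulrN opprK.
  have loj : (r t ^+ 4) ^+ 3 <= D * frob_inner (dblcomm (A t)) (dblcomm (A t)) ^+ 2.
    by rewrite r4; exact: selfcomm_lojasiewicz.
  have small : r t ^+ 4 <= (2 * D)^-1 ^+ 2 by rewrite r4; exact: ET.
  have gE : g t ^+ 2 =
      16 * (frob_inner (dblcomm (A t)) (dblcomm (A t)) - (r t ^+ 4) ^+ 2).
    by rewrite r4; apply: sphere_grad_sqnorm; have [] := flowA t0.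
  exact: lojasiewicz_gradient r0 D1 (frob_inner_ge0 _) loj small
    (normr_ge0 _) gE.
Qed.

(** In place of integrating the speed: [<A, W> + |W| u] is nonincreasing because [|grad E| <= - u'],
    and it is bounded below; it converges, and so does [u]. *)
Lemma flow_cvg (T : R) (u du : R -> R) : 0 <= T ->
  (forall t : R, T <= t ->
    [/\ is_derive t 1 u (du t), 0 <= u t & `|sphere_grad (A t)| <= - du t]) ->
  exists L : cmat R d, A t @[t --> +oo] --> L.
Proof.
move=> T0 uP; apply: cvg_of_frob_inner => W.
have du0 t : T <= t -> du t <= 0.
  by move=> /uP[_ _ h]; rewrite -oppr_ge0 (le_trans _ h).
have ud t : T <= t -> is_derive t 1 u (du t) by move=> /uP[].
have [lu ulu] : exists l : R, u t @[t --> +oo] --> l.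
  apply: (@nonincreasing_ge_cvg _ _ T 0); first exact: ler0_is_derive ud du0.
  by move=> t /uP[].
pose f t := frob_inner (A t) W + `|W| * u t.
pose df t := frob_inner (- sphere_grad (A t)) W + `|W| * du t.
have fd t : T <= t -> is_derive t 1 f (df t).
  move=> Tt; have [_ dA] := flowA (le_trans T0 Tt).
  have dW := is_derive_frob_innerl W dA.
  exact: is_deriveD dW (is_deriveZ `|W| (ud t Tt)).
have [lf flf] : exists l : R, f t @[t --> +oo] --> l.
  apply: (@nonincreasing_ge_cvg _ _ T (- `|W|)).
    apply: ler0_is_derive fd _ => t Tt; have [_ _ gu] := uP t Tt.
    have := frob_inner_le_norm (- sphere_grad (A t)) W.
    move=> /(le_trans (ler_norm _)); rewrite normrN /df => h.
    have := ler_wpM2l (normr_ge0 W) gu; rewrite mulrN; move: h.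
    by rewrite [_ * `|W|]mulrC; lra.
  move=> t Tt; have [_ u0 _] := uP t Tt.
  have [A1 _] := flowA (le_trans T0 Tt); rewrite /unit_sphere /= in A1.
  have := frob_inner_le_norm (A t) W; rewrite A1 mul1r ler_norml => /andP[h _].
  by rewrite /f; apply: le_trans h _; rewrite lerDl mulr_ge0.
exists (lf - `|W| * lu).
have -> : (fun t => frob_inner (A t) W) = (fun t => f t - `|W| * u t).
  by apply/funext => t; rewrite /f addrK.
by apply: cvgB => //; exact: cvgZl_tmp.
Qed.

End FlowLimit.

(** * Norm, normality and realness of the limit *)

Section LimitProperties.

Local Open Scope sesquilinear_scope.
Local Open Scope complex_scope.

Context {R : realType} {d : nat}.
Local Notation C := R[i].
Local Notation Re := complex.Re.
Local Notation Im := complex.Im.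

Definition conj_cmat (B : cmat R d) : cmat R d := map_mx Num.conj (B : 'M[C]_d).

Lemma frob_inner_conj (B W : cmat R d) :
  frob_inner (conj_cmat B) (conj_cmat W) = frob_inner B W.
Proof.
rewrite !frob_innerE; apply: eq_bigr => i _; apply: eq_bigr => j _.
by rewrite !mxE; case: (B i j) (W i j) => [a b] [a' b'] /=; ring.
Qed.

Lemma conj_cmatB (B W : cmat R d) :
  conj_cmat (B - W) = conj_cmat B - conj_cmat W.
Proof. exact: map_mxB. Qed.

Lemma conj_cmatZ (a : R) (B : cmat R d) : conj_cmat (a *: B) = a *: conj_cmat B.
Proof.
apply/matrixP => i j; rewrite !mxE rmorphM; congr (_ * _).
exact: conjc_real.
Qed.

Lemma selfcomm_conj (B : cmat R d) :
  selfcomm (conj_cmat B) = conj_cmat (selfcomm B).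
Proof.
by rewrite /selfcomm conj_cmatB /conj_cmat !map_mxM !map_trmx.
Qed.

Lemma dblcomm_conj (B : cmat R d) :
  dblcomm (conj_cmat B) = conj_cmat (dblcomm B).
Proof.
rewrite /dblcomm selfcomm_conj; move: (selfcomm B) => M.
by rewrite conj_cmatB /conj_cmat !map_mxM.
Qed.

Lemma sphere_grad_conj (B : cmat R d) :
  sphere_grad (conj_cmat B) = conj_cmat (sphere_grad B).
Proof.
rewrite /sphere_grad conj_cmatZ conj_cmatB conj_cmatZ dblcomm_conj.
by rewrite !nonnormalityE selfcomm_conj frob_inner_conj.
Qed.

Lemma unit_sphere_conj (B : cmat R d) :
  unit_sphere B -> unit_sphere (conj_cmat B).
Proof. by rewrite !unit_sphereE frob_inner_conj. Qed.

Lemma realmx_conj (B : cmat R d) :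
  ((B : 'M[C]_d) \is a realmx) <-> conj_cmat B = B.
Proof.
split=> [/mxOverP Breal|BE].
  by apply/matrixP => i j; rewrite mxE; apply/CrealP.
by apply/mxOverP => i j; apply/CrealP; rewrite -{2}BE mxE.
Qed.

Variable A : R -> cmat R d.
Hypothesis flowA : is_sphere_flow A.

(* The conjugate trajectory solves the same Lipschitz equation. *)
Lemma flow_real : conj_cmat (A 0) = A 0 ->
  forall t : R, 0 <= t -> conj_cmat (A t) = A t.
Proof.
move=> A0real.
pose D t : cmat R d := A t - conj_cmat (A t).
pose D' t : cmat R d := - sphere_grad (A t) - conj_cmat (- sphere_grad (A t)).
have dD (t : R) : 0 <= t -> is_mxderive D t (D' t).
  move=> t0; have dA := flow_mxderive flowA t0.
  apply: (is_mxderiveB dA) => i j; rewrite mxE; under eq_fun do rewrite mxE.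
  exact: is_cderive_conj.
have DE t : D' t = - (sphere_grad (A t) - sphere_grad (conj_cmat (A t))).
  by rewrite /D' sphere_grad_conj -scaleN1r conj_cmatZ !scaleN1r opprD.
pose Y t := frob_inner (D t) (D t).
suff Y0 : forall t : R, 0 <= t -> Y t = 0.
  move=> t t0; have /frob_inner_eq0/eqP := Y0 t t0.
  by rewrite subr_eq0 => /eqP.
(* [256] is twice the Lipschitz constant [128], since [Y' = 2 <D', D>]. *)
apply: (@gronwall_eq0 _ Y
  (fun t => frob_inner (D' t) (D t) + frob_inner (D t) (D' t)) 256).
- by move=> t t0; exact: is_derive_frob_inner (dD t t0) (dD t t0).
- move=> t t0; rewrite [X in _ + X]frob_innerC.
  have [SA _] := flowA t0.
  have lip := sphere_grad_lipschitz SA (unit_sphere_conj SA).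
  have CS := frob_inner_le_norm (D' t) (D t).
  have D'n : `|D' t| <= 128 * `|D t| by rewrite DE normrN.
  have h := ler_wpM2r (normr_ge0 (D t)) D'n.
  rewrite -mulrA -expr2 cmat_sqr_norm -/(Y t) in h.
  have := le_trans (ler_norm _) (le_trans CS h).
  by set a := frob_inner _ _; set b := Y t; lra.
- by move=> t _; exact: frob_inner_ge0.
- by rewrite /Y /D A0real subrr -(scale0r (0 : cmat R d)) frob_innerZl mul0r.
Qed.

Variable L : cmat R d.
Hypothesis AL : A t @[t --> +oo] --> L.

Lemma near_pinfty_dist (e : R) : 0 < e ->
  exists T : R, forall t, T < t -> `|A t - L| < e.
Proof.
move=> e0; move/cvgrPdist_lt : AL => /(_ e e0) [T [_ TP]].
by exists T => t /TP; rewrite distrC.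
Qed.

Lemma limit_norm : `|L| = 1.
Proof.
apply/eqP; rewrite -subr_eq0 -normr_le0; apply/ler_addgt0Pr => e e0; rewrite add0r.
have [T TP] := near_pinfty_dist e0.
pose t := Num.max 0 T + 1.
have t0 : 0 <= t by rewrite addr_ge0// le_max lexx.
have [<- _] := flowA t0.
apply: le_trans (ler_dist_dist _ _) _.
by rewrite distrC ltW// TP// ltr_pwDr// le_max lexx orbT.
Qed.

Lemma limit_normal :
  (forall e : R, 0 < e ->
     exists2 T : R, 0 <= T & forall t, T <= t -> nonnormality (A t) <= e) ->
  (L : 'M[C]_d) \is normalmx.
Proof.
move=> Esmall; suff M0 : selfcomm L = 0.
  by apply/normalmxP/eqP; rewrite -subr_eq0; apply/eqP.
suff : `|(selfcomm L : cmat R d)| <= 0 by rewrite normr_le0 => /eqP.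
apply/ler_addgt0Pr => e e0; rewrite add0r.
(* The Lipschitz constant [4] of [selfcomm] turns [e / 8] into [e / 2]; energy at most
   [(e / 2) ^+ 2] gives the other half. *)
have e4 : 0 < e / 8 by rewrite divr_gt0.
have e22 : 0 < (e / 2) ^+ 2 by rewrite exprn_gt0// divr_gt0.
have [T TP] := near_pinfty_dist e4.
have [T' T'0 T'P] := Esmall _ e22.
pose t := Num.max T T' + 1.
have Tt : T < t by rewrite ltr_pwDr// le_max lexx.
have T't : T' <= t.
  by apply: ltW; rewrite ltr_pwDr// le_max lexx orbT.
have [At1 _] := flowA (le_trans T'0 T't).
have h1 := selfcomm_lipschitz limit_norm At1.
have h2 : `|(selfcomm (A t) : cmat R d)| <= e / 2.
  rewrite -ler_sqr ?nnegrE//; last by rewrite divr_ge0// ltW.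
  exact: T'P.
have h3 := TP t Tt; rewrite distrC in h3.
have := ler_normD (selfcomm L - selfcomm (A t) : cmat R d) (selfcomm (A t) : cmat R d).
rewrite subrK => h4.
by move: h1 h2 h3 h4; lra.
Qed.

Lemma limit_real : (forall t : R, 0 <= t -> conj_cmat (A t) = A t) ->
  conj_cmat L = L.
Proof.
move=> Areal; apply/eqP; rewrite -subr_eq0 -normr_le0; apply/ler_addgt0Pr => e e0; rewrite add0r.
have e2 : 0 < e / 2 by rewrite divr_gt0.
have [T TP] := near_pinfty_dist e2.
pose t := Num.max 0 T + 1.
have t0 : 0 <= t by rewrite addr_ge0// le_max lexx.
have Tt : T < t by rewrite ltr_pwDr// le_max lexx orbT.
have h := TP t Tt.
(* As [A t] is its own conjugate, it cancels; the two remaining terms have equal norm. *)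
have -> : conj_cmat L - L = (A t - L) - conj_cmat (A t - L).
  by rewrite conj_cmatB Areal// opprB [RHS]addrC addrA subrK.
apply: le_trans (ler_normB _ _) _.
have -> : `|conj_cmat (A t - L)| = `|A t - L|.
  by rewrite !cmat_normE !frob_norm_inner frob_inner_conj.
lra.
Qed.

End LimitProperties.

(** * Non-nilpotent matrices and the convergence theorem *)

Lemma exists_trace_pow_neq0 (F : numFieldType) d (B : 'M[F]_d) : (0 < d)%N ->
  ~ nilpotent_mx B -> exists k, \tr (B ^+ k.+1) <> 0.
Proof.
case: d B => // n B _ Bnil; apply: contrapT => /forallNP tr0.
by apply/Bnil/nilpotent_of_traces => k; exact: contrapT (tr0 k).
Qed.

Theorem theorem3p1 (R : realType) (d : nat) (hd : (1 <= d)%N)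
    (F : cmat R d -> R -> cmat R d)
    (hF : is_negative_gradient_flow (@unit_sphere R d) (@nonnormality R d) F)
    (A0 : cmat R d) (hA0 : unit_sphere A0) (hnil : ~ nilpotent_mx A0) :
  exists Ainf : cmat R d,
    [/\ F A0 t @[t --> +oo] --> Ainf,
        (Ainf : 'M[complex R]_d) \is normalmx,
        `|Ainf| = 1 &
        ((A0 : 'M[complex R]_d) \is a realmx ->
         (Ainf : 'M[complex R]_d) \is a realmx)].
Proof.
have [A [flowA A00 AF]] := negative_gradient_flow_extension hF hA0.
have [k trk] := exists_trace_pow_neq0 hd hnil.
rewrite -A00 in trk.
have Esmall := energy_small flowA trk.
have [T [u [du [T0 uP]]]] := exists_length_bound flowA hd Esmall.
have [L AL] := flow_cvg flowA T0 uP.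
exists L; split.
- apply: cvg_trans AL; apply: near_eq_cvg; near=> t.
  by rewrite AF//; near: t; exact: nbhs_pinfty_ge (num_real 0).
- exact: (limit_normal flowA AL Esmall).
- exact: (limit_norm flowA AL).
- move=> /realmx_conj A0real; apply/realmx_conj.
  apply: (limit_real AL); apply: (flow_real flowA).
  by rewrite A00.
Unshelve. all: by end_near.
Qed.
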